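(* If $\Sigma$ is a vertical line segment (of positive length) in $\mathbb{R}^3$, then $$\lim_{k\rightarrow\infty}\frac{\delta(\Xi(k,4)+\Sigma)}{\delta(\Xi(k,4))}=2.$$
   Context: $\delta(P)$ denotes the diameter of a polytope $P$, i.e. the diameter of its graph of vertices and edges; $P+Q$ is the Minkowski sum. In $\mathbb{R}^3$, the plane $\mathbb{R}^2=\{z=0\}$ and its parallels are called horizontal, and lines or planes parallel to the $z$-axis are called vertical. The polytope $\Xi(k,l)$, for integers $k\geq2$ and $l\geq2$, is a $3$-dimensional polytope (one is fixed for each $k,l$) described as follows. Let $A\subset\mathbb{R}^2$ be a regular polygon with $2k$ vertices and edges $E_1,\dots,E_{2k}$ in cyclic order. The vertices of $\Xi(k,l)$ are: (1) the $2k$ vertices of $A$ (blue vertices); (2) for each odd $i$, $l-1$ red vertices slightly above $\mathbb{R}^2$, and for each even $i$, $l-1$ green vertices slightly below $\mathbb{R}^2$, whose orthogonal projections on $\mathbb{R}^2$ are distinct points in the relative interior of $E_i$; (3) the $kl$ vertices of a horizontal facet $T^+$ lying above all the red vertices and the $kl$ vertices of a congruent horizontal facet $T^-$ lying below all the green vertices. The orthogonal projection of $\Xi(k,l)$ on $\mathbb{R}^2$ is $A$. The facets of $\Xi(k,l)$ are exactly: (a) $T^+$ and $T^-$; (b) for each $i$, a vertical facet $F_i$, a convex polygon with $l+1$ vertices, namely the two endpoints of $E_i$ and the $l-1$ red (if $i$ is odd) or green (if $i$ is even) vertices projecting on $E_i$; its edges are the horizontal edge $E_i$ and a chain of $l$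 other edges joining the endpoints of $E_i$ through the red or green vertices; (c) $2kl$ quadrilaterals: for each odd (resp. even) $i$ and each of the $l$ edges in the chain of $F_i$, a quadrilateral having that edge and an edge of $T^+$ (resp. $T^-$) as two opposite edges, each edge of $T^+$ and of $T^-$ belonging to exactly one such quadrilateral; (d) $2k$ isosceles triangles: for each even (resp. odd) $i$, the convex hull of $E_i$ and a vertex of $T^+$ (resp. $T^-$). Finally, $\Xi(k,l)$ is symmetric with respect to each vertical plane containing the midpoints of two opposite edges of $A$. *)

(* Defs.v *)
From HB Require Import structures.
From mathcomp Require Import all_boot all_order all_algebra.
From mathcomp Require Import all_classical all_reals all_analysis.
Import Order.TTheory GRing.Theory Num.Theory.
Import numFieldNormedType.Exports.

Set Implicit Arguments.
Unset Strict Implicit.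
Unset Printing Implicit Defensive.

Local Open Scope classical_set_scope.
Local Open Scope ring_scope.

Section Polytopes.
Context {R : realType} {n : nat}.
Implicit Types (u v x y : 'rV[R]_n) (A P Q F : set 'rV[R]_n).

(* The norm carried by ['rV[R]_n] in the library is the sup norm; Euclidean
   notions go through the standard scalar product instead. *)
Definition dotv x y : R := \sum_i x 0 i * y 0 i.
Definition sqdist x y : R := dotv (x - y) (x - y).

Definition congruent A B : Prop :=
  exists f : 'rV[R]_n -> 'rV[R]_n,
    (forall x y, sqdist (f x) (f y) = sqdist x y) /\ f @` A = B.

(* reflection in the hyperplane through [m] with normal [w] (for [w != 0]) *)
Definition reflection (w m x : 'rV[R]_n) : 'rV[R]_n :=
  x - (2 * dotv w (x - m) / dotv w w) *: w.

Definition segment u v : set 'rV[R]_n :=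
  [set (1 - t) *: u + t *: v | t in [set t : R | 0 <= t <= 1]].
Definition open_segment u v : set 'rV[R]_n :=
  [set (1 - t) *: u + t *: v | t in [set t : R | 0 < t < 1]].

Definition conv_hull A : set 'rV[R]_n := smallest (@convex_set R 'rV[R]_n) A.

Definition minkowski_sum P Q : set 'rV[R]_n :=
  [set x + y | x in P & y in Q].

Definition affinely_independent d (p : 'I_d.+1 -> 'rV[R]_n) : bool :=
  row_free (\matrix_(i < d) (p (lift ord0 i) - p ord0)).

Definition has_dim A (d : nat) : Prop :=
  (exists p : 'I_d.+1 -> 'rV[R]_n,
      (forall i, A (p i)) /\ affinely_independent p) /\
  ~ (exists p : 'I_d.+2 -> 'rV[R]_n,
      (forall i, A (p i)) /\ affinely_independent p).

Definition is_polytope P : Prop :=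
  exists s : seq 'rV[R]_n, P = conv_hull [set` s].

(* For a nonempty polytope these are exactly its nonempty faces, the polytope
   itself being obtained with [c = 0]. *)
Definition is_face P F : Prop :=
  exists c : 'rV[R]_n, F = [set x | P x /\ forall y, P y -> dotv c y <= dotv c x].

Definition is_vertex P v : Prop := is_face P [set v].
Definition is_edge P F : Prop := is_face P F /\ has_dim F 1.
Definition is_facet P F : Prop :=
  is_face P F /\ exists d, has_dim P d.+1 /\ has_dim F d.

Definition adjacent P u v : Prop := is_edge P (segment u v).

Definition walk P u v (m : nat) : Prop :=
  exists p : nat -> 'rV[R]_n,
    [/\ p 0%N = u, p m = v & forall i, (i < m)%N -> adjacent P (p i) (p i.+1)].

Definition graph_dist P u v : \bar R :=
  ereal_inf [set (m%:R)%:E | m in [set m : nat | walk P u v m]].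

(* The graph of a polytope is finite and connected, so that [fine] is applied
   to a finite value when [P] is a nonempty polytope. *)
Definition diameter P : R :=
  fine (ereal_sup [set graph_dist P uv.1 uv.2 |
    uv in [set uv | is_vertex P uv.1 /\ is_vertex P uv.2]]).

(* [Q] is a quadrilateral with opposite edges [ab] and [cd]; the cyclic order
   of its vertices is either a, b, c, d or a, b, d, c. *)
Definition is_quadrilateral Q (a b c d : 'rV[R]_n) : Prop :=
  [/\ uniq [:: a; b; c; d],
      forall v, is_vertex Q v <-> v \in [:: a; b; c; d],
      is_edge Q (segment a b) & is_edge Q (segment c d)].

End Polytopes.

Section Xi.
Context {R : realType}.
Local Notation pt := 'rV[R]_3.
Implicit Types (p : pt) (S P : set pt).

Definition xcoord p : R := p 0 0.
Definition ycoord p : R := p 0 1.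
Definition zcoord p : R := p 0 2.

Definition mkpt (x y z : R) : pt := \row_(i < 3) [:: x; y; z]`_i.

Definition proj p : pt := mkpt (xcoord p) (ycoord p) 0.

(* vertical line segment of positive length *)
Definition vertical_segment S : Prop :=
  exists a b : pt,
    [/\ a != b, xcoord a = xcoord b, ycoord a = ycoord b & S = segment a b].

(* Vertices of the horizontal regular [n]-gon with centre (x, y, 0),
   circumradius [r] and phase [th], in cyclic order; [i] is read modulo [n]. *)
Definition ngon (n : nat) (x y r th : R) (i : nat) : pt :=
  mkpt (x + r * cos (th + i%:R * (2 * pi) / n%:R))
       (y + r * sin (th + i%:R * (2 * pi) / n%:R)) 0.

Definition midpoint (u v : pt) : pt := 2^-1 *: (u + v).

Definition edge_index (k i : nat) : bool := (1 <= i <= k.*2)%N.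

Definition facet_F (l : nat) (c : nat -> nat -> pt) (i : nat) : set pt :=
  conv_hull [set c i j | j in [set j | (j <= l)%N]].
Definition facet_D (a t : nat -> pt) (i : nat) : set pt :=
  conv_hull [set a i; a i.+1; t i].

(* The description of the polytope Xi(k, l) in terms of
   - [a], the vertices of the regular polygon A: [a i] and [a i.+1] are the
     endpoints of the edge E_i, 1 <= i <= 2k;
   - [c i j], 0 <= j <= l, the successive vertices of the chain of F_i, from
     [c i 0 = a i] to [c i l = a i.+1]; those with 0 < j < l are red if [i] is
     odd and green if [i] is even;
   - [T true] and [T false], the facets T^+ and T^-;
   - [Q i j], j < l, the quadrilateral having the edge from [c i j] to
     [c i j.+1] of F_i as an edge;
   - [t i], the vertex of [T (~~ odd i)] that spans a triangle with E_i. *)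
Record Xi_spec (k l : nat) (P : set pt) (a : nat -> pt) (c : nat -> nat -> pt)
    (T : bool -> set pt) (Q : nat -> nat -> set pt) (t : nat -> pt) : Prop := {
  Xi_polytope : is_polytope P;
  Xi_dim : has_dim P 3;

  Xi_regular : exists x y r th : R, 0 < r /\ a = ngon k.*2 x y r th;
  Xi_proj : [set proj p | p in P] =
    conv_hull [set a i | i in [set i | edge_index k i]];

  Xi_chain_ends : forall i, edge_index k i -> c i 0%N = a i /\ c i l = a i.+1;
  Xi_colored : forall i j, edge_index k i -> (0 < j < l)%N ->
    open_segment (a i) (a i.+1) (proj (c i j)) /\
    (if odd i then 0 < zcoord (c i j) else zcoord (c i j) < 0);
  Xi_colored_distinct : forall i j j', edge_index k i ->
    (0 < j < l)%N -> (0 < j' < l)%N -> proj (c i j) = proj (c i j') -> j = j';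

  Xi_T_horizontal : forall s, exists h : R,
    (forall p, T s p -> zcoord p = h) /\
    (forall i j, edge_index k i -> odd i = s -> (0 < j < l)%N ->
       if s then zcoord (c i j) < h else h < zcoord (c i j));
  Xi_T_card : forall s, ([set v | is_vertex (T s) v] #= `I_(k * l))%card;
  Xi_T_congruent : congruent (T true) (T false);

  Xi_vertices : forall v, is_vertex P v <->
    [\/ exists2 i, edge_index k i & v = a i,
        exists i j, [/\ edge_index k i, (0 < j < l)%N & v = c i j] |
        exists s, is_vertex (T s) v];

  Xi_facets : forall G, is_facet P G <->
    [\/ exists s, G = T s,
        exists2 i, edge_index k i & G = facet_F l c i,
        exists i j, [/\ edge_index k i, (j < l)%N & G = Q i j] |
        exists2 i, edge_index k i & G = facet_D a t i];

  Xi_F_vertices : forall i, edge_index k i -> forall v,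
    is_vertex (facet_F l c i) v <-> exists2 j, (j <= l)%N & v = c i j;
  Xi_F_edges : forall i, edge_index k i -> forall e,
    is_edge (facet_F l c i) e <->
    e = segment (a i) (a i.+1) \/
    exists2 j, (j < l)%N & e = segment (c i j) (c i j.+1);

  Xi_Q_quad : forall i j, edge_index k i -> (j < l)%N ->
    exists u v, adjacent (T (odd i)) u v /\
      is_quadrilateral (Q i j) (c i j) (c i j.+1) u v;
  Xi_Q_unique : forall s e, is_edge (T s) e ->
    exists! ij : nat * nat,
      [/\ edge_index k ij.1, odd ij.1 = s, (ij.2 < l)%N
        & is_edge (Q ij.1 ij.2) e];

  Xi_D_apex : forall i, edge_index k i -> is_vertex (T (~~ odd i)) (t i);
  Xi_D_isosceles : forall i, edge_index k i ->
    sqdist (a i) (t i) = sqdist (a i.+1) (t i);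

  (* [w] ranges over the horizontal normals of the vertical planes through the
     midpoints of the opposite edges E_i and E_(i + k). *)
  Xi_symmetric : forall i (w : pt), (1 <= i <= k)%N ->
    let m := midpoint (a i) (a i.+1) in
    let m' := midpoint (a (i + k)%N) (a (i + k).+1) in
    w != 0 -> zcoord w = 0 -> dotv w (m' - m) = 0 ->
    [set reflection w m p | p in P] = P
}.

Definition is_Xi (k l : nat) (P : set pt) : Prop :=
  exists a c T Q t, Xi_spec k l P a c T Q t.

End Xi.

(* Main.v *)
Require Import Defs.
From HB Require Import structures.
From mathcomp Require Import all_boot all_order all_algebra.
From mathcomp Require Import all_classical all_reals all_analysis.
From mathcomp Require Import zify ring lra.
Import Order.TTheory GRing.Theory Num.Theory.
Import numFieldNormedType.Exports.
Import Defs.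

Local Open Scope classical_set_scope.
Local Open Scope ring_scope.

(** Why the limit is 2. Every vertex of [Xi(k, l)] is at most [l + 1] steps away
    from the polygon [A], so that both diameters are, up to a bounded term, the
    cost of going half-way around [A].

    On [Xi] this cost is [k], the polygon itself being a shortest way. In the sum
    with a vertical segment, every blue vertex is split into a top and a bottom
    copy joined by a vertical edge, and only one copy of each edge [E_i] of [A]
    remains an edge: the chain of coloured vertices takes the place of the top
    copy if [i] is odd, of the bottom copy if [i] is even. To advance by two
    edges of [A] one may zigzag, along one copy of an edge, a vertical edge, one
    copy of the next edge and another vertical edge, which takes 4 steps; or stay
    on one side, where a chain takes [l] steps, as does following the facet [T^+]
    or [T^-]. For [l = 4] nothing is gained over the zigzag, and the cost is
    [2 * k].

    The upper bounds exhibit these walks ([within_Xi], [within_sum]). The lower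
    bounds place the vertices on a cycle of length [4 * k] in such a way that an
    edge advances by at most 2 on [Xi] ([position]) and by at most 1 on the sum
    ([sum_position]), while two of the vertices are antipodal.

    This requires the edges of [Xi], of which only the facets are given. An edge
    of a polytope of dimension 3 lies on two facets ([edge_two_facets]). Hence an
    edge from a coloured vertex to [T^+] is common to the two quadrilaterals on
    the chain edges at this vertex, and an edge from a blue vertex to [T^+] is
    common to a quadrilateral and a triangle. The quadrilaterals of the chains
    with odd index and the triangles with even index thus follow each other
    around [T^+], which gives a list of its vertices ([rim]); it is without
    repetition because [T^+] has [k * l] vertices ([rim_inj]). Likewise for
    [T^-]. All edges are then known ([edge_cases]). Those which remain on the top
    of the sum are exposed by a linear form that increases upwards; such a form
    is not maximal at a point below the plane of [A], whose projection is in the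
    polytope ([face_signed]).

    The geometry underneath is that of a polytope given as the hull of a finite
    set: it is the hull of its vertices ([polytope_vertices], from the theorem of
    the alternative [gordan]), and a face of a face is a face ([face_of_face]). *)

Set Implicit Arguments.
Unset Strict Implicit.
Unset Printing Implicit Defensive.

(** * Scalar product, convex hulls and faces *)

Section Dot.
Context {R : realType} {n : nat}.
Implicit Types (u v x y c d : 'rV[R]_n) (t : R).

Lemma dotvC x y : dotv x y = dotv y x.
Proof. by apply: eq_bigr => i _; rewrite mulrC. Qed.

Lemma dotvDr c x y : dotv c (x + y) = dotv c x + dotv c y.
Proof. by rewrite -big_split; apply: eq_bigr => i _; rewrite mxE mulrDr. Qed.

Lemma dotvZr c t x : dotv c (t *: x) = t * dotv c x.
Proof.
by rewrite /dotv mulr_sumr; apply: eq_bigr => i _; rewrite mxE mulrCA.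
Qed.

Lemma dotvDl c d x : dotv (c + d) x = dotv c x + dotv d x.
Proof. by rewrite dotvC dotvDr !(dotvC x). Qed.

Lemma dotvZl t c x : dotv (t *: c) x = t * dotv c x.
Proof. by rewrite dotvC dotvZr dotvC. Qed.

Lemma dotvNr c x : dotv c (- x) = - dotv c x.
Proof. by rewrite -scaleN1r dotvZr mulN1r. Qed.

Lemma dotvNl c x : dotv (- c) x = - dotv c x.
Proof. by rewrite dotvC dotvNr dotvC. Qed.

Lemma dotv0r c : dotv c 0 = 0.
Proof. by rewrite -(scale0r 0) dotvZr mul0r. Qed.

Lemma dotv0l c : dotv 0 c = 0.
Proof. by rewrite dotvC dotv0r. Qed.

Definition dotvE := (dotvDr, dotvDl, dotvNr, dotvNl, dotvZr, dotvZl).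

Lemma dotvv_ge0 x : 0 <= dotv x x.
Proof. by apply: sumr_ge0 => i _; rewrite -expr2 sqr_ge0. Qed.

Lemma dotvv_eq0 x : (dotv x x == 0) = (x == 0).
Proof.
apply/idP/eqP => [|->]; last by rewrite dotv0r.
rewrite psumr_eq0 => [/allP h|i _]; last by rewrite -expr2 sqr_ge0.
apply/rowP => i; have := h i (mem_index_enum i).
by rewrite mxE /= mulf_eq0 orbb => /eqP.
Qed.

Lemma dotvv_gt0 x : (0 < dotv x x) = (x != 0).
Proof. by rewrite lt_def dotvv_ge0 andbT dotvv_eq0. Qed.

Lemma dotv_subvv_gt0 x y : x != y -> dotv (x - y) y < dotv (x - y) x.
Proof. by move=> xy; rewrite -subr_gt0 -dotvNr -dotvDr dotvv_gt0 subr_eq0. Qed.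

End Dot.

Section Hull.
Context {R : realType} {n : nat}.
Local Notation pt := 'rV[R]_n.
Implicit Types (u v x y z c d : pt) (A C P F : set pt) (s : seq pt) (t m : R).

Definition conv_closed C :=
  forall x y t, 0 <= t <= 1 -> C x -> C y -> C ((1 - t) *: x + t *: y).

Lemma convex_setP C : @convex_set R pt C <-> conv_closed C.
Proof.
split=> [h x y t /andP[t0 t1] Cx Cy | h x y l].
  have := h y x (@Itv.mk _ _ _ t _).
  have p : Itv.spec (@Itv.num_sem R) (Itv.Real `[0, 1]%Z) t.
    by rewrite /Itv.spec /= /Itv.num_sem /= num_real /= in_itv /= t0.
  move=> /(_ p); rewrite !inE => /(_ Cy Cx).
  by rewrite /conv /= addrC.
rewrite !inE => Cx Cy.
have := h y x l%:num _ Cy Cx.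
rewrite /conv /= addrC; apply.
by rewrite ge0 le1.
Qed.

Definition hull s : set pt := conv_hull [set` s].

Lemma conv_hull_conv A : conv_closed (conv_hull A).
Proof.
move=> x y t t01 hx hy C [cC AC].
by apply: (proj1 (convex_setP C) cC) => //; [exact: hx|exact: hy].
Qed.

Lemma conv_hull_min A C : conv_closed C -> A `<=` C -> conv_hull A `<=` C.
Proof. by move=> cC; apply: smallest_sub; apply/convex_setP. Qed.

Lemma sub_conv_hull A : A `<=` conv_hull A.
Proof. exact: sub_gen_smallest. Qed.

Lemma conv_hull_mono A C : A `<=` conv_hull C -> conv_hull A `<=` conv_hull C.
Proof. by apply: conv_hull_min; exact: conv_hull_conv. Qed.

Lemma mem_hull s x : x \in s -> hull s x.
Proof. by move=> xs; apply: sub_conv_hull. Qed.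

Lemma halfspace_conv c m : conv_closed [set x | dotv c x <= m].
Proof.
move=> x y t /andP[t0 t1] /= hx hy; rewrite !dotvE.
nra.
Qed.

Lemma conv_hull_le A c m : (forall x, A x -> dotv c x <= m) ->
  forall x, conv_hull A x -> dotv c x <= m.
Proof.
move=> h; suff : conv_hull A `<=` [set x | dotv c x <= m] by [].
by apply: conv_hull_min; [exact: halfspace_conv|move=> x /h].
Qed.

(** A convex combination of points below a hyperplane reaches it only if all
    the points that it uses lie on it. *)
Lemma conv_hull_level A c m : (forall x, A x -> dotv c x <= m) ->
  forall x, conv_hull A x -> dotv c x = m ->
  conv_hull [set y | A y /\ dotv c y = m] x.
Proof.
move=> h x hx; set B := [set y | _].
suff : conv_hull A `<=` [set x | dotv c x <= m /\ (dotv c x = m -> conv_hull B x)].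
  by move=> /(_ x hx) [].
move=> {x hx}; apply: conv_hull_min => [x y t t01 [xm hx] [ym hy]|x Ax]; last first.
  by split; [exact: h|move=> e; apply: sub_conv_hull; split].
split; first exact: halfspace_conv.
rewrite !dotvE => e; have /andP[t0 t1] := t01.
have [t00|t0'] := eqVneq t 0.
  by rewrite t00 subr0 scale1r scale0r addr0; apply: hx; rewrite -e t00; lra.
have [t11|t1'] := eqVneq t 1.
  by rewrite t11 subrr scale1r scale0r add0r; apply: hy; rewrite -e t11; lra.
have {}t0 : 0 < t by rewrite lt_def t0'.
have {}t1 : t < 1 by rewrite lt_neqAle t1'.
by apply: conv_hull_conv => //; [apply: hx|apply: hy]; apply/eqP; rewrite eq_le ?xm ?ym /=; nra.
Qed.

Definition face P c : set pt :=
  [set x | P x /\ forall y, P y -> dotv c y <= dotv c x].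

Lemma face_sub P c : face P c `<=` P. Proof. by move=> x []. Qed.

Lemma face_eqval P c x y : face P c x -> P y ->
  face P c y <-> dotv c y = dotv c x.
Proof.
move=> [Px hx] Py; split=> [[_ hy]|e].
  by apply/eqP; rewrite eq_le hx // hy.
by split=> // z /hx; rewrite e.
Qed.

Lemma conv_hull_face A c x0 : face (conv_hull A) c x0 ->
  face (conv_hull A) c = conv_hull [set x | A x /\ dotv c x = dotv c x0].
Proof.
move=> fx0; have [Ax0 hx0] := fx0.
apply/seteqP; split=> x.
  move=> fx; have [Ax _] := fx.
  have /(face_eqval fx0 Ax) e := fx.
  apply: conv_hull_level => // y Ay; apply: hx0; exact: sub_conv_hull.
move=> hx; have Ax : conv_hull A x.
  by apply: conv_hull_mono hx => y [Ay _]; exact: sub_conv_hull.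
apply/(face_eqval fx0) => //; apply/eqP; rewrite eq_le hx0 //=.
rewrite -lerN2 -!dotvNl.
by apply: conv_hull_le hx => y [_]; rewrite !dotvNl => ->.
Qed.

(** A form bounded on the generators by its value at a point of the hull is
    bounded by it on the hull. *)
Lemma conv_hull_faceP A c x0 : conv_hull A x0 ->
  (forall x, A x -> dotv c x <= dotv c x0) ->
  face (conv_hull A) c = conv_hull [set x | A x /\ dotv c x = dotv c x0].
Proof.
by move=> hx h; apply: conv_hull_face; split=> // y; exact: conv_hull_le.
Qed.

Lemma conv_hull0 : conv_hull (set0 : set pt) = set0.
Proof.
by apply/seteqP; split=> // x; apply: (@conv_hull_min set0 set0).
Qed.

Lemma conv_hull1 x : conv_hull [set x] = [set x].
Proof.
apply/seteqP; split; last exact: sub_conv_hull.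
apply: conv_hull_min => // y z t _ -> ->.
by rewrite -scalerDl subrK scale1r.
Qed.

Lemma segment_hull u v : segment u v = conv_hull [set u; v].
Proof.
apply/seteqP; split=> [x [t /= t01 <-]|].
  by apply: conv_hull_conv => //; apply: sub_conv_hull; [left|right].
apply: conv_hull_min => [_ _ t t01 [a /= a01 <-] [b /= b01 <-]|x [->|->]].
- exists ((1 - t) * a + t * b) => /=.
    have /andP[? ?] := t01; have /andP[? ?] := a01; have /andP[? ?] := b01.
    by apply/andP; split; nra.
  rewrite !scalerDr !scalerA [RHS]addrACA -!scalerDl.
  by congr (_ *: _ + _ *: _); ring.
- by exists 0; rewrite /= ?lexx ?ler01 // subr0 scale1r scale0r addr0.
- by exists 1; rewrite /= ?lexx ?ler01 // subrr scale1r scale0r add0r.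
Qed.

Lemma segmentl u v : segment u v u.
Proof. by rewrite segment_hull; apply: sub_conv_hull; left. Qed.

Lemma segmentr u v : segment u v v.
Proof. by rewrite segment_hull; apply: sub_conv_hull; right. Qed.

Lemma segmentC u v : segment u v = segment v u.
Proof. by rewrite !segment_hull setUC. Qed.

(** Only a generator can be a vertex of a hull: a singleton face is the hull of
    the generators that it contains. *)
Lemma vertex_conv_hull A v : is_vertex (conv_hull A) v -> A v.
Proof.
move=> [c e]; have fv : face (conv_hull A) c v by rewrite /face -e.
have := conv_hull_face fv.
rewrite {1}/face -e; set B := [set x | _] => eB.
have [x [Ax xv]] : exists x, B x.
  apply: contrapT => nB; have B0 : B = set0.
    by apply/seteqP; split=> // x Bx; apply: nB; exists x.
  by move: eB; rewrite B0 conv_hull0 => /seteqP[+ _] => /(_ v erefl).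
have xv' : [set v] x by rewrite eB; apply: sub_conv_hull.
by rewrite -xv'.
Qed.

Lemma vertex_mem P v : is_vertex P v -> P v.
Proof. by move=> [c e]; have [] : face P c v by rewrite /face -e. Qed.

(** The form exposing [v] in [P] exposes it in every subset that contains it. *)
Lemma vertex_subset P F v : F `<=` P -> is_vertex P v -> F v -> is_vertex F v.
Proof.
move=> FP [c e] Fv; exists c; apply/seteqP; split=> x.
  move=> ->; split=> // y /FP Py; have [_] : face P c v by rewrite /face -e.
  exact.
move=> [Fx hx]; rewrite e; split; first exact: FP.
have [_ hv] : face P c v by rewrite /face -e.
by move=> y /hv /le_trans; apply; exact: hx.
Qed.

End Hull.

(** * Separation and vertices *)

Section Separation.
Context {R : realType} {n : nat}.
Local Notation pt := 'rV[R]_n.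
Implicit Types (u v x y z c d : pt) (P F : set pt) (s : seq pt) (t m e : R).

(** Finitely many strict inequalities survive a small enough perturbation. *)
Lemma small_perturbation (T : eqType) (s : seq T) (f g : T -> R) :
  (forall a, a \in s -> 0 < f a) ->
  exists2 e0, 0 < e0 & forall e, 0 < e <= e0 ->
    forall a, a \in s -> 0 < f a + e * g a.
Proof.
elim: s => [_|a s IH h]; first by exists 1.
have [|e1 e10 he1] := IH; first by move=> x xs; apply: h; rewrite inE xs orbT.
have fa : 0 < f a by apply: h; rewrite inE eqxx.
have g1 : 0 < 1 + `|g a| by rewrite ltr_wpDr.
exists (Num.min e1 (f a / (1 + `|g a|))).
  by rewrite lt_min e10 divr_gt0.
move=> e /andP[e0]; rewrite le_min => /andP[ee1]; rewrite ler_pdivlMr // => ea x.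
rewrite inE => /orP[/eqP->|]; last by apply: he1; rewrite e0.
have := ler_norm (- g a); rewrite normrN => ga.
have : 0 <= e * (`|g a| + g a) by rewrite mulr_ge0 ?(ltW e0) //; lra.
by move: ea; rewrite !mulrDr mulr1; move=> h1 h2; lra.
Qed.

(** The cone over a hull is convex, so that vectors may be rescaled before they
    are combined. *)
Lemma cone_conv s : conv_closed [set x | exists2 mu : R, 0 < mu & hull s (mu *: x)].
Proof.
move=> x y t /andP[t0 t1] [mu mu0 hx] [nu nu0 hy] /=.
set a := (1 - t) / mu + t / nu.
have a0 : 0 < a.
  have [t00|t0'] := eqVneq t 0.
    by rewrite /a t00 mul0r addr0 subr0 divr_gt0.
  by rewrite ltr_wpDl ?divr_ge0 ?divr_gt0 ?subr_ge0 ?(ltW mu0) // lt_def t0'.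
exists a^-1; first by rewrite invr_gt0.
have -> : a^-1 *: ((1 - t) *: x + t *: y) =
  (1 - t / nu / a) *: (mu *: x) + (t / nu / a) *: (nu *: y).
  rewrite scalerDr !scalerA; congr (_ *: _ + _ *: _).
    have -> : 1 - t / nu / a = (1 - t) / mu / a.
      have aN0 : a != 0 by rewrite gt_eqF.
      by rewrite -[in LHS](divff aN0) -mulrBl {1}/a addrK.
    by field; rewrite !gt_eqF.
  by field; rewrite !gt_eqF.
apply: conv_hull_conv => //.
have u0 : 0 <= t / nu by rewrite divr_ge0 // ltW.
have v0 : 0 <= (1 - t) / mu by rewrite divr_ge0 ?subr_ge0 // ltW.
apply/andP; split; first by rewrite divr_ge0 // ltW.
by rewrite ler_pdivrMr // mul1r /a; lra.
Qed.

(** The theorem of the alternative of Gordan. When the form found for the other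
    vectors is negative at [y], these vectors are moved along [y] into its
    kernel, which leaves one vector less to treat. *)
Lemma gordan s : (exists c, forall x, x \in s -> 0 < dotv c x) \/ hull s 0.
Proof.
have [k] := ubnP (size s); elim: k s => // k IH [_|y s].
  by left; exists 0.
rewrite ltnS /= => sk.
have [[c hc]|h0] := IH s sk; last first.
  right; apply: conv_hull_mono h0 => x /= xs; apply: mem_hull.
  by rewrite inE xs orbT.
have [cy|cy|cy] := ltgtP (dotv c y) 0; last 2 first.
- by left; exists c => x; rewrite inE => /orP[/eqP->|/hc].
- have [y0|y0] := eqVneq y 0.
    by right; apply: mem_hull; rewrite y0 inE eqxx.
  have [e e0 he] := small_perturbation (dotv y) hc.
  left; exists (c + e *: y) => x; rewrite inE !dotvE => /orP[/eqP->|xs].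
    by rewrite cy add0r mulr_gt0 // dotvv_gt0.
  by apply: he => //; rewrite e0 lexx.
pose f x := x - (dotv c x / dotv c y) *: y.
have [] := IH (map f s); first by rewrite size_map.
  move=> [c' hc'].
  pose c2 := c' - (dotv c' y / dotv c y) *: c.
  have c2y : dotv c2 y = 0 by rewrite /c2 !dotvE; field; rewrite lt_eqF.
  have c2x x : x \in s -> 0 < dotv c2 x.
    move=> xs; have := hc' _ (map_f f xs).
    by rewrite /f /c2 !dotvE; congr (_ < _); field; rewrite lt_eqF.
  move: c2 c2y c2x => c2 c2y c2x.
  have [e e0 he] := small_perturbation (fun x => - dotv c x) c2x.
  left; exists (c2 - e *: c) => x; rewrite inE !dotvE => /orP[/eqP->|xs].
    by rewrite c2y add0r; nra.
  by rewrite -mulrN; apply: he => //; rewrite e0 lexx.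
move=> h0; right.
suff /(_ 0 h0)[mu _] : hull (map f s) `<=`
    [set x | exists2 mu : R, 0 < mu & hull (y :: s) (mu *: x)].
  by rewrite scaler0.
apply: conv_hull_min; first exact: cone_conv.
move=> _ /mapP[x xs ->]; have cx := hc _ xs.
set t := - dotv c x / dotv c y.
have t0 : 0 < t by rewrite /t nmulr_lgt0 ?invr_lt0 // oppr_lt0.
exists (1 + t)^-1; first by rewrite invr_gt0; lra.
have -> : (1 + t)^-1 *: f x = (1 - t / (1 + t)) *: x + (t / (1 + t)) *: y.
  rewrite /f scalerBr scalerA -scaleNr -mulrN -mulNr -/t.
  by congr (_ *: _ + _ *: _); field; rewrite gt_eqF //; lra.
apply: conv_hull_conv; last 2 first.
- by apply: sub_conv_hull; rewrite /= inE xs orbT.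
- by apply: sub_conv_hull; rewrite /= inE eqxx.
have t1 : 0 < 1 + t by lra.
by rewrite divr_ge0 ?(ltW t0) ?(ltW t1) //= ler_pdivrMr //; lra.
Qed.

(** The alternative of Gordan for the vectors from the generators to [y]. *)
Lemma separation s y : ~ hull s y ->
  exists c, forall x, x \in s -> dotv c x < dotv c y.
Proof.
move=> hy; have [[c hc]|h0] := gordan (map (fun x => y - x) s).
  exists c => x xs; have := hc _ (map_f _ xs).
  by rewrite !dotvE subr_gt0.
case: hy.
suff /(_ 0 h0) : hull (map (fun x => y - x) s) `<=` [set w | hull s (y - w)].
  by rewrite /= subr0.
apply: conv_hull_min => [u v t t01 hu hv|_ /mapP[x xs ->]] /=; last first.
  by rewrite opprB addrC subrK; apply: mem_hull.
have -> : y - ((1 - t) *: u + t *: v) = (1 - t) *: (y - u) + t *: (y - v).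
  by apply/rowP => i; rewrite !mxE; ring.
exact: conv_hull_conv.
Qed.

(** A generator that is not in the hull of the other ones can be separated from
    them, hence is a vertex; a generator that is in it can be discarded. *)
Lemma polytope_vertices P : is_polytope P ->
  exists s, P = hull s /\ forall x, x \in s <-> is_vertex P x.
Proof.
move=> [s0 ->].
suff [s [-> hs]] : exists s, conv_hull [set` s0] = hull s /\
    forall x, x \in s -> is_vertex (hull s) x.
  exists s; split=> // x; split; first exact: hs.
  by move/vertex_conv_hull.
have [k] := ubnP (size s0); elim: k s0 => // k IH s; rewrite ltnS => sk.
have [[x xs hx]|no] := pselect (exists2 x, x \in s & hull [seq y <- s | y != x] x).
  have [|s' [e hs']] := IH [seq y <- s | y != x].
    rewrite size_filter (leq_trans _ sk) // -(count_predC (pred1 x)) addnC.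
    by rewrite -[X in (X < _)%N]addn0 ltn_add2l -has_count has_pred1.
  exists s'; split=> //; rewrite -e; apply/seteqP; split; apply: conv_hull_mono.
    move=> y /= ys; have [->//|yx] := eqVneq y x.
    by apply: mem_hull; rewrite mem_filter yx.
  by move=> y /=; rewrite mem_filter => /andP[_]; exact: mem_hull.
exists s; split=> // x xs.
have [c hc] : exists c, forall y, y \in [seq y <- s | y != x] -> dotv c y < dotv c x.
  by apply: separation => hx; apply: no; exists x.
have {}hc y : y \in s -> y != x -> dotv c y < dotv c x.
  by move=> ys yx; apply: hc; rewrite mem_filter yx.
exists c; rewrite -/(face _ c) (@conv_hull_faceP _ _ _ _ x) ; last 2 first.
- exact: mem_hull.
- by move=> y ys; have [->//|/(hc _ ys)/ltW] := eqVneq y x.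
rewrite -[LHS]conv_hull1; congr (conv_hull _); apply/seteqP; split=> y.
  by move=> ->.
move=> /= [ys e]; apply/eqP; apply: contraT => /(hc _ ys).
by rewrite e ltxx.
Qed.

(** A linear form that dominates the second one by a large enough multiple of
    the first supports the polytope at the face of the face. *)
Lemma face_of_face P c d x0 : is_polytope P -> face (face P c) d x0 ->
  exists2 M, 0 < M & face P (M *: c + d) = face (face P c) d.
Proof.
move=> [s ->] fx0; have [fx0c hx0] := fx0; have [Px0 cx0] := fx0c.
have [|e e0 he] := @small_perturbation pt [seq x <- s | dotv c x < dotv c x0]
    (fun x => dotv c x0 - dotv c x) (fun x => dotv d x0 - dotv d x).
  by move=> x; rewrite mem_filter subr_gt0 => /andP[].
have {}he x : x \in s -> dotv c x < dotv c x0 ->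
    dotv (e^-1 *: c + d) x < dotv (e^-1 *: c + d) x0.
  move=> xs xlt; have := he e; rewrite e0 lexx => /(_ isT x).
  rewrite mem_filter xlt xs => /(_ isT) => h.
  rewrite -subr_gt0; have : 0 < e^-1 * (dotv c x0 - dotv c x + e * (dotv d x0 - dotv d x)).
    by rewrite mulr_gt0 ?invr_gt0.
  by rewrite mulrDr mulKf ?gt_eqF // !dotvE; lra.
have hd x : x \in s -> dotv c x = dotv c x0 -> dotv d x <= dotv d x0.
  move=> xs e1; apply: hx0; apply/(face_eqval fx0c) => //; exact: mem_hull.
have le_c x : x \in s -> dotv c x <= dotv c x0.
  by move=> xs; apply: cx0; exact: mem_hull.
exists e^-1; first by rewrite invr_gt0.
rewrite (@conv_hull_faceP _ _ _ _ x0) //; last first.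
  move=> x xs; have := le_c x xs; rewrite le_eqVlt => /orP[/eqP e1|].
    by rewrite !dotvE e1; have := hd x xs e1; lra.
  by move=> /(he _ xs)/ltW.
move: (fx0); rewrite (conv_hull_face fx0c) => /conv_hull_face ->.
congr (conv_hull _); apply/seteqP; split=> x /=.
  move=> [xs e1]; have e2 : dotv c x = dotv c x0.
    have := le_c x xs; rewrite le_eqVlt => /orP[/eqP//|].
    by move=> /(he _ xs); rewrite e1 ltxx.
  by split; [split|move: e1; rewrite !dotvE e2; lra].
by move=> [[xs e1] e2]; split=> //; rewrite !dotvE e1 e2.
Qed.

Lemma is_face_trans P F G x : is_polytope P -> is_face P F -> is_face F G ->
  G x -> is_face P G.
Proof.
move=> pP [c eF] [d eG] Gx.
have fx : face (face P c) d x by rewrite /face -eF -eG.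
have [M _ e] := face_of_face pP fx.
by exists (M *: c + d); rewrite -/(face _ _) e eG eF.
Qed.

Lemma is_vertex_trans P F v : is_polytope P -> is_face P F -> is_vertex F v ->
  is_vertex P v.
Proof. by move=> pP fF vF; exact: (is_face_trans pP fF vF (x := v)). Qed.

Lemma is_polytope_face P F x : is_polytope P -> is_face P F -> F x ->
  is_polytope F.
Proof.
move=> [s ->] [c ->] fx; rewrite -/(face _ _) (conv_hull_face (x0 := x)) //.
exists [seq y <- s | dotv c y == dotv c x]; congr (conv_hull _).
apply/seteqP; split=> y /=; rewrite mem_filter.
  by move=> [ys ->]; rewrite eqxx.
by move=> /andP[/eqP].
Qed.

Lemma face_subset P G c x : face P c x -> face P c `<=` G -> G `<=` P ->
  face P c = face G c.
Proof.
move=> fx FG GP; apply/seteqP; split=> y.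
  by move=> fy; split; [exact: FG|move=> z /GP; apply: fy.2].
move=> [Gy hy]; split; first exact: GP.
by move=> z /fx.2 /le_trans; apply; apply: hy; exact: FG.
Qed.

(** The sum of two forms is maximal where both are, as soon as both can be at
    once. *)
Lemma faceI P c d x : face P c x -> face P d x ->
  face P (c + d) = face P c `&` face P d.
Proof.
move=> fc fd; apply/seteqP; split=> y.
  move=> [Py hy]; have Px := fc.1.
  have h := hy _ Px; rewrite !dotvE in h.
  have h1 := fc.2 _ Py; have h2 := fd.2 _ Py.
  by split; [apply/(face_eqval fc)|apply/(face_eqval fd)] => //; lra.
move=> [fyc fyd]; split; first exact: fyc.1.
by move=> z Pz; rewrite !dotvE lerD ?fyc.2 ?fyd.2.
Qed.

End Separation.

(** * Edges *)

Section Edges.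
Context {R : realType} {n : nat}.
Local Notation pt := 'rV[R]_n.
Implicit Types (u v w x y z c d : pt) (P F G : set pt) (s : seq pt) (t m e : R).

Lemma vertexP P v : is_vertex P v ->
  P v /\ exists c, forall x, P x -> x != v -> dotv c x < dotv c v.
Proof.
move=> vv; split; first exact: vertex_mem.
have [c e] := vv; exists c => x Px xv.
have fv : face P c v by rewrite /face -e.
rewrite lt_neqAle fv.2 // andbT; apply: contra_neq xv => exv.
by have : [set v] x by rewrite e; apply/(face_eqval fv).
Qed.

Lemma segment_vertexP u v x : is_vertex (segment u v) x <-> x = u \/ x = v.
Proof.
rewrite segment_hull; split; first by move/vertex_conv_hull.
suff h w y : is_vertex (conv_hull [set w; y]) w.
  by move=> [->|->]; [exact: h|rewrite setUC; exact: h].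
have le z : [set w; y] z -> dotv (w - y) z <= dotv (w - y) w.
  move=> [->//|->]; have [->|wy] := eqVneq w y; first by [].
  by rewrite ltW // dotv_subvv_gt0.
exists (w - y); rewrite -/(face _ _) (@conv_hull_faceP _ _ _ _ w) //; last first.
  by apply: sub_conv_hull; left.
rewrite -[LHS]conv_hull1; congr (conv_hull _); apply/seteqP; split=> z.
  by move=> ->; split=> //; left.
move=> /= [[->//|->] e]; apply/eqP; apply: contraT => yw.
have := @dotv_subvv_gt0 _ _ w y; rewrite eq_sym yw => /(_ isT).
by rewrite e ltxx.
Qed.

Lemma segment_inj u v u' v' : segment u v = segment u' v' ->
  (u = u' /\ v = v') \/ (u = v' /\ v = u').
Proof.
move=> e.
have h x : (x = u \/ x = v) <-> (x = u' \/ x = v').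
  by rewrite -!segment_vertexP e.
have [/(h u) hu /(h v) hv] : (u = u \/ u = v) /\ (v = u \/ v = v).
  by split; [left|right].
have [/(h u') hu' /(h v') hv'] : (u' = u' \/ u' = v') /\ (v' = u' \/ v' = v').
  by split; [left|right].
by move: hu hv hu' hv' {e h} => [] ? [] ? [] ? [] ?; subst; tauto.
Qed.

Lemma has_dim_segment u v : has_dim (segment u v) 1 <-> u != v.
Proof.
split=> [[[p [hp ip]] _]|uv].
  apply: contraTneq ip => uv.
  have hx x : segment u v x -> x = v.
    by rewrite uv segment_hull setUid conv_hull1.
  rewrite /affinely_independent (_ : \matrix_(_ < _) _ = 0).
    by rewrite /row_free mxrank0.
  by apply/row_matrixP => i; rewrite rowK row0 (hx _ (hp _)) (hx _ (hp ord0)) subrr.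
split.
  exists (fun i => if i == ord0 then u else v); split.
    by move=> i; case: ifP => _; [exact: segmentl|exact: segmentr].
  rewrite /affinely_independent /row_free (_ : \matrix_(_ < _) _ = v - u).
    by rewrite rank_rV subr_eq0 (eq_sym v) uv.
  by apply/row_matrixP => i; rewrite rowK ord1 row_id.
move=> [p [hp ip]].
have /choice[r hr] : forall i, exists r : R, p i = u + r *: (v - u).
  move=> i; have [t _ <-] := hp i; exists t.
  by apply/rowP => j; rewrite !mxE; ring.
move: ip; rewrite /affinely_independent /row_free.
rewrite (_ : \matrix_(_ < _) _ =
    (\col_i (r (lift ord0 i) - r ord0)) *m (v - u)) => [/eqP rk|].
  by have := mulmx_max_rank (\col_i (r (lift ord0 i) - r ord0)) (v - u); rewrite rk.
apply/row_matrixP => i; rewrite rowK row_mul !hr.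
by apply/rowP => j; rewrite !mxE big_ord1 !mxE; ring.
Qed.

Lemma adjacentP P u v : adjacent P u v <-> u != v /\ is_face P (segment u v).
Proof.
by split=> [[fe /has_dim_segment]|[/has_dim_segment]].
Qed.

Lemma adjacentC P u v : adjacent P u v -> adjacent P v u.
Proof. by rewrite /adjacent segmentC. Qed.

Lemma adjacent_neq P u v : adjacent P u v -> u != v.
Proof. by move/adjacentP => []. Qed.

Lemma adjacent_vertexl P u v : is_polytope P -> adjacent P u v -> is_vertex P u.
Proof.
move=> pP /adjacentP[_ fe]; apply: (is_vertex_trans pP fe).
by apply/segment_vertexP; left.
Qed.

Lemma adjacent_vertexr P u v : is_polytope P -> adjacent P u v -> is_vertex P v.
Proof. by move=> pP /adjacentC; exact: adjacent_vertexl. Qed.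

Lemma adjacent_trans P F u v : is_polytope P -> is_face P F -> adjacent F u v ->
  adjacent P u v.
Proof.
move=> pP fF /adjacentP[uv fe]; apply/adjacentP; split=> //.
exact: (is_face_trans pP fF fe (segmentl u v)).
Qed.

Lemma polytope_conv P : is_polytope P -> conv_closed P.
Proof. by move=> [s ->]; exact: conv_hull_conv. Qed.

Lemma face_conv P c : is_polytope P -> conv_closed (face P c).
Proof.
move=> pP x y t t01 fx fy; split.
  by apply: polytope_conv => //; [exact: fx.1|exact: fy.1].
move=> z Pz; rewrite !dotvE; have := fx.2 z Pz; have := fy.2 z Pz.
by have /andP[? ?] := t01; nra.
Qed.

Lemma is_face_conv P F : is_polytope P -> is_face P F -> conv_closed F.
Proof. by move=> pP [c ->]; exact: face_conv. Qed.

Lemma segment_sub P u v : conv_closed P -> P u -> P v -> segment u v `<=` P.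
Proof.
by move=> cP Pu Pv; rewrite segment_hull; apply: conv_hull_min => // x [->|->].
Qed.

Lemma adjacent_sub P F u v : is_polytope P -> is_face P F ->
  adjacent P u v -> F u -> F v -> adjacent F u v.
Proof.
move=> pP fF /adjacentP[uv [c e]] Fu Fv; apply/adjacentP; split=> //.
have fu : face P c u by rewrite /face -e; exact: segmentl.
exists c; rewrite e -/(face _ _) -/(face _ _); apply: (face_subset fu).
  rewrite /face -e; apply: segment_sub => //; exact: is_face_conv fF.
by have [d ->] := fF; exact: face_sub.
Qed.

(** The vertices generate the polytope, and a face is generated by the
    generators that it contains. *)
Lemma face_hull_vertices P c x0 : is_polytope P -> face P c x0 ->
  face P c = conv_hull [set v | is_vertex P v /\ dotv c v = dotv c x0].
Proof.
move=> /polytope_vertices[s [-> hs]] /conv_hull_face ->.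
by congr (conv_hull _); apply/seteqP; split=> v /= [/hs].
Qed.

Lemma face_segment P c u v : is_polytope P -> face P c u -> face P c v ->
  (forall x, is_vertex P x -> face P c x -> x = u \/ x = v) ->
  face P c = segment u v.
Proof.
move=> pP fu fv h; apply/seteqP; split; last first.
  by apply: segment_sub => //; exact: face_conv.
rewrite (face_hull_vertices pP fu) segment_hull; apply: conv_hull_mono.
move=> x [vx ex]; apply: sub_conv_hull; apply: h => //.
by apply/(face_eqval fu) => //; exact: vertex_mem.
Qed.

Lemma seq_argmax (T : eqType) (s : seq T) (f : T -> R) a : a \in s ->
  exists2 b, b \in s & forall a', a' \in s -> f a' <= f b.
Proof.
elim: s a => // b s IH a _.
have [->|] := eqVneq s [::].
  by exists b; rewrite ?inE // => a'; rewrite inE => /eqP->.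
case: s IH => // a0 s IH _.
have [|d ds hd] := IH a0; first by rewrite inE eqxx.
have [bd|db] := leP (f b) (f d).
  by exists d => [|a']; rewrite inE ?ds ?orbT // => /orP[/eqP->|/hd].
exists b => [|a']; rewrite inE ?eqxx // => /orP[/eqP->|/hd] //.
by move=> /le_trans; apply; exact: ltW.
Qed.

(** The vertices on a line are at most two: the form exposing the middle one of
    three would increase both ways. *)
Lemma vertices_not_collinear P x g l m : is_vertex P x ->
  is_vertex P (x + l *: g) -> is_vertex P (x + m *: g) ->
  [&& l != 0, m != 0 & l != m] -> g != 0 -> False.
Proof.
move=> v0 vl vm /and3P[l0 m0 lm] g0.
have inj r r' : r != r' -> x + r *: g != x + r' *: g.
  apply: contra_neq => /addrI /eqP; rewrite -subr_eq0 -scalerBl scaler_eq0.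
  by rewrite (negPf g0) orbF subr_eq0 => /eqP.
have vx0 : is_vertex P (x + 0 *: g) by rewrite scale0r addr0.
have key r r1 r2 : is_vertex P (x + r *: g) -> is_vertex P (x + r1 *: g) ->
    is_vertex P (x + r2 *: g) -> r1 != r -> r2 != r -> 0 < (r1 - r) * (r2 - r).
  move=> /vertexP[_ [c hc]] /vertex_mem P1 /vertex_mem P2 r1r r2r.
  have := hc _ P1 (inj _ _ r1r); have := hc _ P2 (inj _ _ r2r).
  rewrite !dotvE !ltrD2l -subr_gt0 -mulrBl => h2.
  rewrite -subr_gt0 -mulrBl => h1.
  have : 0 < ((r1 - r) * (r2 - r)) * (dotv c g) ^+ 2.
    by have := mulr_gt0 h1 h2; congr (_ < _); ring.
  have cg : dotv c g != 0 by apply: contraTneq h1 => ->; rewrite mulr0 ltxx.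
  by rewrite pmulr_lgt0 // exprn_even_gt0.
have k0 := key 0 l m vx0 vl vm l0 m0.
have k1 := key l 0 m vl vx0 vm.
have k2 := key m 0 l vm vx0 vl.
move: k1 k2; rewrite ![0 == _]eq_sym l0 m0 [m == l]eq_sym lm => /(_ isT isT) k1.
move=> /(_ isT isT) k2; rewrite !subr0 in k0; nra.
Qed.

(** Seen from a vertex [v] exposed by [c], the other vertices [u] are radially
    projected to [y u], on a hyperplane; a farthest of these projections from
    the origin is exposed there, by itself, so that the ray through it carries
    an edge. *)
Lemma vertex_in_edge P v v' : is_polytope P -> is_vertex P v -> is_vertex P v' ->
  v' != v -> exists w, adjacent P v w.
Proof.
move=> pP vv vv' v'v.
have [s [eP hs]] := polytope_vertices pP.
have [Pv [c hc]] := vertexP vv.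
pose h u := dotv c (v - u); pose y u := (h u)^-1 *: (u - v).
have h_gt0 u : P u -> u != v -> 0 < h u.
  by move=> Pu uv; rewrite /h !dotvE subr_gt0; exact: hc.
have yE u : P u -> u != v -> u = v + h u *: y u.
  move=> Pu uv; rewrite /y scalerA divff ?gt_eqF ?h_gt0 // scale1r.
  by rewrite addrC subrK.
have cy u : P u -> u != v -> dotv c (y u) = -1.
  move=> Pu uv; rewrite /y dotvZr -opprB dotvNr -/(h u) mulrN mulVf //.
  by rewrite gt_eqF ?h_gt0.
move: y yE cy => y yE cy.
have v's : v' \in [seq u <- s | u != v] by rewrite mem_filter v'v; apply/hs.
have [w] := seq_argmax (fun u => dotv (y u) (y u)) v's.
rewrite mem_filter => /andP[wv ws] hw.
have vw : is_vertex P w by apply/hs.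
have Pw := vertex_mem vw.
pose f := y w + dotv (y w) (y w) *: c.
have fE u : P u -> u != v ->
    dotv f u = dotv f v + h u * (dotv (y w) (y u) - dotv (y w) (y w)).
  move=> Pu uv; rewrite {1}(yE u Pu uv) dotvDr dotvZr; congr (_ + _ * _).
  by rewrite /f !dotvE cy // mulrN1.
have yy u : is_vertex P u -> u != v -> dotv (y w) (y u) <= dotv (y w) (y w) /\
    (dotv (y w) (y u) = dotv (y w) (y w) -> y u = y w).
  move=> vu uv; have := hw u; rewrite mem_filter uv => /(_ (proj2 (hs u) vu)) le.
  have := dotvv_ge0 (y w - y u); rewrite !dotvE (dotvC (y u) (y w)) => ge0.
  split; first by lra.
  move=> e; apply/eqP; rewrite eq_sym -subr_eq0 -dotvv_eq0 eq_le dotvv_ge0 andbT.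
  by rewrite !dotvE (dotvC (y u) (y w)); lra.
have fv : face P f v.
  rewrite eP; split; first by rewrite -/(hull s) -eP.
  apply: conv_hull_le => u /= /hs vu; have [->//|uv] := eqVneq u v.
  have Pu := vertex_mem vu.
  by rewrite fE //; have := h_gt0 u Pu uv; have [? _] := yy u vu uv; nra.
have fw : face P f w by apply/(face_eqval fv) => //; rewrite fE // subrr mulr0 addr0.
exists w; apply/adjacentP; split; first by rewrite eq_sym.
exists f; rewrite -/(face _ _); symmetry; apply: face_segment => // u vu fu.
have [->|uv] := eqVneq u v; [by left|right].
have Pu := vertex_mem vu.
have yu : y u = y w.
  apply: (yy u vu uv).2; apply/eqP; rewrite -subr_eq0.
  have /(face_eqval fv Pu)/eqP := fu; rewrite fE // addrC -subr_eq0 addrK.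
  by rewrite mulf_eq0 gt_eqF ?h_gt0.
apply/eqP; apply: contraT => uw; exfalso.
apply: (@vertices_not_collinear P v (y w) (h u) (h w)) => //.
- by rewrite -yu -yE.
- by rewrite -yE.
- rewrite (gt_eqF (h_gt0 u Pu uv)) (gt_eqF (h_gt0 w Pw wv)) /=; apply: contra_neq uw => e.
  by rewrite (yE u Pu uv) (yE w Pw wv) yu e.
- by apply: contra_neq (wv) => e; rewrite (yE w Pw wv) e scaler0 addr0.
Qed.

End Edges.

(** * Facets in three dimensions *)

Section Space.
Context {R : realType}.
Local Notation pt := 'rV[R]_3.
Implicit Types (a b c d f g u v w x y z : pt) (P Q F G : set pt) (t m e : R).

Lemma dotv3 x y : dotv x y = x 0 0 * y 0 0 + x 0 1 * y 0 1 + x 0 2 * y 0 2.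
Proof.
rewrite /dotv !big_ord_recl big_ord0 addr0 addrA.
by congr (_ * _ + _ * _ + _ * _); congr (_ 0 _); apply/val_inj.
Qed.

Lemma eq_row3 x y : x 0 0 = y 0 0 -> x 0 1 = y 0 1 -> x 0 2 = y 0 2 -> x = y.
Proof.
move=> h0 h1 h2; apply/rowP => -[[|[|[|//]]] i3].
- by rewrite (_ : Ordinal i3 = 0) //; apply/val_inj.
- by rewrite (_ : Ordinal i3 = 1) //; apply/val_inj.
- by rewrite (_ : Ordinal i3 = 2) //; apply/val_inj.
Qed.

Lemma mkptE r0 r1 r2 : ((mkpt r0 r1 r2 : pt) 0 0 = r0) *
  ((mkpt r0 r1 r2 : pt) 0 1 = r1) * ((mkpt r0 r1 r2 : pt) 0 2 = r2).
Proof. by rewrite /mkpt !mxE. Qed.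

Definition cross x y : pt :=
  mkpt (x 0 1 * y 0 2 - x 0 2 * y 0 1) (x 0 2 * y 0 0 - x 0 0 * y 0 2)
       (x 0 0 * y 0 1 - x 0 1 * y 0 0).

Lemma dotv_crossl x y : dotv x (cross x y) = 0.
Proof. by rewrite dotv3 /cross !mkptE; ring. Qed.

Lemma dotv_crossr x y : dotv y (cross x y) = 0.
Proof. by rewrite dotv3 /cross !mkptE; ring. Qed.

(** The cross product [g] of [c] and [d] satisfies
    [w x g = (d.w) c - (c.w) d], so that [w] is parallel to [g]. *)
Lemma cross_span c d w : dotv c w = 0 -> dotv d w = 0 ->
  dotv (cross c d) (cross c d) *: w = dotv (cross c d) w *: cross c d.
Proof.
move=> cw dw; set g := cross c d.
(* the components of [w x g], then those of [|g|^2 w - (g . w) g = g x (w x g)] *)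
have h0 : w 0 1 * g 0 2 - w 0 2 * g 0 1 = 0.
  transitivity (dotv d w * c 0 0 - dotv c w * d 0 0).
    by rewrite /g !dotv3 /cross !mkptE; ring.
  by rewrite cw dw !mul0r subrr.
have h1 : w 0 2 * g 0 0 - w 0 0 * g 0 2 = 0.
  transitivity (dotv d w * c 0 1 - dotv c w * d 0 1).
    by rewrite /g !dotv3 /cross !mkptE; ring.
  by rewrite cw dw !mul0r subrr.
have h2 : w 0 0 * g 0 1 - w 0 1 * g 0 0 = 0.
  transitivity (dotv d w * c 0 2 - dotv c w * d 0 2).
    by rewrite /g !dotv3 /cross !mkptE; ring.
  by rewrite cw dw !mul0r subrr.
move: g h0 h1 h2 => g h0 h1 h2.
apply: eq_row3; rewrite !mxE !dotv3; apply/eqP; rewrite -subr_eq0; apply/eqP.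
- transitivity (g 0 1 * (w 0 0 * g 0 1 - w 0 1 * g 0 0) -
                g 0 2 * (w 0 2 * g 0 0 - w 0 0 * g 0 2)); first by ring.
  by rewrite h1 h2 !mulr0 subrr.
- transitivity (g 0 2 * (w 0 1 * g 0 2 - w 0 2 * g 0 1) -
                g 0 0 * (w 0 0 * g 0 1 - w 0 1 * g 0 0)); first by ring.
  by rewrite h0 h2 !mulr0 subrr.
- transitivity (g 0 0 * (w 0 2 * g 0 0 - w 0 0 * g 0 2) -
                g 0 1 * (w 0 1 * g 0 2 - w 0 2 * g 0 1)); first by ring.
  by rewrite h0 h1 !mulr0 subrr.
Qed.

Lemma cross_neq0 c d w : c != 0 -> dotv c w = 0 -> dotv d w != 0 ->
  cross c d != 0.
Proof.
move=> c0 cw; apply: contra_neq => g0.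
have e : dotv c c * dotv d w = dotv c d * dotv c w.
  have E i : cross c d 0 i = 0 by rewrite g0 mxE.
  have := E 0; have := E 1; have := E 2; rewrite /cross !mkptE => e2 e1 e0.
  apply/eqP; rewrite -subr_eq0; apply/eqP.
  transitivity (w 0 0 * (c 0 2 * (c 0 2 * d 0 0 - c 0 0 * d 0 2) - c 0 1 * (c 0 0 * d 0 1 - c 0 1 * d 0 0))
              + w 0 1 * (c 0 0 * (c 0 0 * d 0 1 - c 0 1 * d 0 0) - c 0 2 * (c 0 1 * d 0 2 - c 0 2 * d 0 1))
              + w 0 2 * (c 0 1 * (c 0 1 * d 0 2 - c 0 2 * d 0 1) - c 0 0 * (c 0 2 * d 0 0 - c 0 0 * d 0 2))).
    by rewrite !dotv3; ring.
  by rewrite e0 e1 e2 !mulr0 subrr !mulr0 !addr0.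
by move/eqP: e; rewrite cw mulr0 mulf_eq0 dotvv_eq0 (negPf c0) => /eqP.
Qed.

(** The zero form exposes the whole polytope, whose dimension is not that of a
    facet. *)
Lemma facetP P G : is_facet P G -> exists2 c, c != 0 & G = face P c.
Proof.
move=> [[c e] [d [[[p [hp ip]] _] [_ hG]]]]; exists c => //.
apply: contra_notN hG => /eqP c0; exists p; split=> // i.
by rewrite e c0; split=> // y _; rewrite !dotv0l.
Qed.

Definition planar F := exists2 c, c != 0 & forall x y, F x -> F y -> dotv c x = dotv c y.

Lemma facet_planar P G : is_facet P G -> planar G.
Proof.
move=> /facetP[c c0 ->]; exists c => // x y fx fy.
by symmetry; apply/(face_eqval fx) => //; exact: fy.1.
Qed.

(** The differences of four affinely independent points form an invertible
    matrix, so that only the zero form vanishes on them. *)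
Lemma has_dim3_not_planar P : has_dim P 3 -> ~ planar P.
Proof.
move=> [[p [hp ip]] _] [c c0 hc]; case/negP: c0.
move: ip; rewrite /affinely_independent row_free_unit => iA.
set A := (\matrix_(_ < _) _) in iA.
have : A *m c^T = 0.
  apply/matrixP => i j; rewrite !mxE [j]ord1.
  have := hc _ _ (hp (lift ord0 i)) (hp ord0).
  rewrite /dotv => /eqP; rewrite -subr_eq0 -sumrB => /eqP e; rewrite -[RHS]e.
  by apply: eq_bigr => k _; rewrite !mxE; ring.
move=> /(congr1 (mulmx (invmx A))); rewrite mulmxA mulVmx // mul1mx mulmx0.
by move=> /(congr1 trmx); rewrite trmxK trmx0 => ->.
Qed.

(** The form [d] separates [w] from the line through [u] and [v]. *)
Lemma planar_has_dim2 F u v w d : planar F -> F u -> F v -> F w -> u != v ->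
  dotv d u = dotv d v -> dotv d w != dotv d u -> has_dim F 2.
Proof.
move=> pF Fu Fv Fw uv duv dwu; split; last first.
  move=> [p [hp ip]]; apply: (@has_dim3_not_planar F) => //.
  split; first by exists p.
  move=> [q [hq iq]]; move: iq; rewrite /affinely_independent /row_free.
  set A := (\matrix_(_ < _) _); have := rank_leq_col A => h /eqP e.
  by rewrite e in h.
exists (fun i => if i == ord0 then u else if i == 1 then v else w); split.
  by move=> i; case: ifP => // _; case: ifP.
rewrite /affinely_independent -kermx_eq0 -submx0; apply/rV_subP => z.
move/sub_kermxP; rewrite mulmx_sum_row !big_ord_recl big_ord0 addr0 !rowK /= => e.
have z1 : z 0 1 = 0.
  have := congr1 (dotv d) e; rewrite dotv0r !dotvE duv subrr mulr0 add0r -duv.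
  move=> /eqP; rewrite mulf_eq0 subr_eq0 (negPf dwu) orbF => /eqP <-.
  by congr (z _ _); apply/val_inj.
have z0 : z 0 0 = 0.
  move/eqP: e; rewrite (_ : lift _ _ = 1); last exact/val_inj.
  rewrite z1 scale0r addr0 scaler_eq0 subr_eq0 (eq_sym v) (negPf uv) orbF.
  by move=> /eqP.
rewrite submx0; apply/eqP/rowP => -[[|[|//]] i2]; rewrite mxE.
  by rewrite -[RHS]z0; congr (z _ _); apply/val_inj.
by rewrite -[RHS]z1; congr (z _ _); apply/val_inj.
Qed.

(** Every form vanishing along an edge [uv] exposed by [c] is tilted by a
    multiple of [c] until it supports the polytope; the extreme tilts of a form
    independent of [c], upwards and downwards, give the two facets. *)
Lemma edge_in_facet P c d u v : is_polytope P -> has_dim P 3 ->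
  adjacent P u v -> face P c = segment u v ->
  dotv d u = dotv d v -> dotv d c = 0 -> d != 0 ->
  exists r w, let f := d + r *: c in
    [/\ is_facet P (face P f), face P f u, face P f v, face P f w &
        dotv c w < dotv c u].
Proof.
move=> pP dP /adjacentP[uv fe] ce duv dc d0.
have [s [eP hs]] := polytope_vertices pP.
have fu : face P c u by rewrite ce; exact: segmentl.
have fv : face P c v by rewrite ce; exact: segmentr.
have Pu := fu.1; have Pv := fv.1.
have cuv : dotv c v = dotv c u by apply/(face_eqval fu).
have sP w : w \in s -> P w by move/hs/vertex_mem.
have cw w : w \in s -> w != u -> w != v -> dotv c w < dotv c u.
  move=> ws wu wv; have Pw := sP w ws.
  rewrite lt_neqAle fu.2 // andbT; apply/eqP => /(face_eqval fu Pw).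
  rewrite ce => sw.
  have /segment_vertexP[] : is_vertex (segment u v) w.
  - apply: (vertex_subset _ (proj1 (hs w) ws) sw).
    by rewrite -ce; exact: face_sub.
  - by apply/eqP.
  - by apply/eqP.
have [w0 [w0s w0u w0v]] : exists w, [/\ w \in s, w != u & w != v].
  apply: contrapT => no; apply: (has_dim3_not_planar dP).
  exists d => // x y; suff h z : P z -> dotv d z = dotv d u by move=> /h-> /h->.
  suff : P `<=` [set z | dotv d z <= dotv d u] /\ P `<=` [set z | dotv (- d) z <= dotv (- d) u].
    move=> [/(_ z) h1 /(_ z) h2] Pz; apply/eqP; rewrite eq_le h1 //=.
    by have := h2 Pz; rewrite /= !dotvNl lerN2.
  have hz z' : z' \in s -> dotv d z' = dotv d u.
    move=> zs; have [->//|zu] := eqVneq z' u; have [->//|zv] := eqVneq z' v.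
    by case: no; exists z'.
  by rewrite eP; split; apply: conv_hull_le => z' zs; rewrite ?dotvNl hz.
pose slope w := dotv d (w - u) / dotv c (u - w).
have w0' : w0 \in [seq w <- s | (w != u) && (w != v)].
  by rewrite mem_filter w0u w0v.
have [w] := seq_argmax slope w0'; rewrite mem_filter => /andP[/andP[wu wv] ws] hw.
set r := slope w in hw.
have cgt0 z : z \in s -> z != u -> z != v -> 0 < dotv c (u - z).
  by move=> zs zu zv; rewrite !dotvE subr_gt0 cw.
have sl z : z \in s -> dotv d (z - u) <= r * dotv c (u - z).
  move=> zs; have [->|zu] := eqVneq z u; first by rewrite subrr !dotv0r mulr0.
  have [->|zv] := eqVneq z v; first by rewrite !dotvE cuv duv !subrr mulr0.
  have := hw z; rewrite mem_filter zu zv zs /slope => /(_ isT).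
  by rewrite ler_pdivrMr ?cgt0.
pose f := d + r *: c.
have fE z : dotv f u - dotv f z = r * dotv c (u - z) - dotv d (z - u).
  by rewrite /f !dotvE; ring.
have ffu : face P f u.
  split=> //; rewrite eP; apply: conv_hull_le => z /sl.
  by rewrite -subr_ge0 -fE subr_ge0.
have fev z : P z -> dotv f z = dotv f u -> face P f z.
  by move=> Pz e; apply/(face_eqval ffu).
have ffv : face P f v by apply: fev => //; rewrite /f !dotvE duv cuv.
have ffw : face P f w.
  apply: fev; first exact: sP.
  apply/eqP; rewrite eq_sym -subr_eq0 fE /r /slope divfK ?subrr //.
  by rewrite gt_eqF // cgt0.
have f0 : f != 0.
  apply: contra_neq d0 => /(congr1 (dotv d)); rewrite dotv0r /f dotvDr dotvZr dc.
  by rewrite mulr0 addr0 => /eqP; rewrite dotvv_eq0 => /eqP.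
exists r, w; split=> //; last exact: cw.
split; first by exists f.
exists 2; split=> //; apply: (@planar_has_dim2 _ u v w c) => //.
  by exists f => // x y fx fy; symmetry; apply/(face_eqval fx) => //; exact: fy.1.
by rewrite lt_eqF // cw.
Qed.

Lemma exists_orthogonal w : exists2 d, d != 0 & dotv d w = 0.
Proof.
have ne (r0 r1 r2 : R) : [|| r0 != 0, r1 != 0 | r2 != 0] -> mkpt r0 r1 r2 != 0.
  apply: contraTneq => e.
  have := congr1 (fun x : pt => x 0 0) e; have := congr1 (fun x : pt => x 0 1) e.
  by have := congr1 (fun x : pt => x 0 2) e; rewrite !mkptE !mxE => -> -> ->; rewrite eqxx.
have [/andP[/eqP w0 /eqP w1]|] := boolP ((w 0 0 == 0) && (w 0 1 == 0)).
  exists (mkpt 1 0 0); first by apply: ne; rewrite oner_eq0.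
  by rewrite dotv3 !mkptE w0; ring.
rewrite negb_and => h; exists (mkpt (- w 0 1) (w 0 0) 0).
  by apply: ne; rewrite oppr_eq0 eqxx orbF orbC.
by rewrite dotv3 !mkptE; ring.
Qed.

(** The two facets differ, as otherwise the polytope would be contained in
    their common plane. *)
Lemma edge_two_facets P u v : is_polytope P -> has_dim P 3 -> adjacent P u v ->
  exists G1 G2, [/\ is_facet P G1, is_facet P G2, G1 <> G2,
    G1 u /\ G1 v & G2 u /\ G2 v].
Proof.
move=> pP dP auv; have /adjacentP[uv [c /esym ce]] := auv.
have fu : face P c u by rewrite /face ce; exact: segmentl.
have fv : face P c v by rewrite /face ce; exact: segmentr.
have Pu := fu.1; have Pv := fv.1.
have cuv : dotv c u = dotv c v by apply/(face_eqval fv).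
have c0 : c != 0.
  apply/eqP => c0; apply: (has_dim3_not_planar dP).
  have [d d0 dw] := exists_orthogonal (v - u).
  have duv : dotv d v = dotv d u by apply/eqP; rewrite -subr_eq0 -dotvNr -dotvDr dw.
  have eP : P = segment u v.
    rewrite -ce c0; apply/seteqP; split=> [x Px|x []//]; split=> // y _.
    by rewrite !dotv0l.
  exists d => // x y; suff h z : P z -> dotv d z = dotv d u by move=> /h-> /h->.
  by rewrite eP => -[t _ <-]; rewrite !dotvE duv; ring.
pose d := cross c (v - u).
have d0 : d != 0.
  apply: (cross_neq0 (w := v - u)) => //; first by rewrite !dotvE cuv subrr.
  by rewrite dotvv_eq0 subr_eq0 eq_sym.
have dc : dotv d c = 0 by rewrite dotvC dotv_crossl.
have duv : dotv d u = dotv d v.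
  apply/eqP; rewrite eq_sym -subr_eq0 -dotvNr -dotvDr dotvC.
  by rewrite dotv_crossr.
move: d d0 dc duv => d d0 dc duv.
have [r1 [w1 [F1 f1u f1v f1w cw1]]] := edge_in_facet pP dP auv ce duv dc d0.
have nd0 : - d != 0 by rewrite oppr_eq0.
have ndc : dotv (- d) c = 0 by rewrite dotvNl dc oppr0.
have nduv : dotv (- d) u = dotv (- d) v by rewrite !dotvNl duv.
have [r2 [w2 [F2 f2u f2v f2w _]]] := edge_in_facet pP dP auv ce nduv ndc nd0.
exists (face P (d + r1 *: c)), (face P (- d + r2 *: c)); split=> // e.
apply: (has_dim3_not_planar dP).
have [c1 c10 ec1] := facetP F1.
exists (d + r1 *: c).
  apply: contra_neq d0 => /(congr1 (dotv d)); rewrite dotv0r dotvDr dotvZr dc.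
  by rewrite mulr0 addr0 => /eqP; rewrite dotvv_eq0 => /eqP.
have Pw1 := f1w.1.
have e1 : dotv (d + r1 *: c) w1 = dotv (d + r1 *: c) u by apply/(face_eqval f1u).
have e2 : dotv (- d + r2 *: c) w1 = dotv (- d + r2 *: c) u.
  by apply/(face_eqval f2u) => //; rewrite -e.
have r12 : r2 = - r1.
  have : (r1 + r2) * (dotv c w1 - dotv c u) = 0.
    by move: e1 e2; rewrite !dotvE; lra.
  move/eqP; rewrite mulf_eq0 subr_eq0 (lt_eqF cw1) orbF addrC addr_eq0.
  by move/eqP.
suff h z : P z -> dotv (d + r1 *: c) z = dotv (d + r1 *: c) u.
  by move=> x y /h-> /h->.
move=> Pz; have := f1u.2 _ Pz; have := f2u.2 _ Pz; rewrite r12 !dotvE; lra.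
Qed.

Lemma facet_face P G : is_facet P G -> is_face P G.
Proof. by case. Qed.

(** The edge [ab] is exposed by [c] and the vertex [a] by [d]; tilting [d] away
    from [c] keeps [b] below [a] until the first of [x] and [y] comes level with
    [a]. Both cannot at the same time, since then [a], [x], [y] would be on the
    line where the tilted plane cuts the plane of [Q]. *)
Lemma quadrilateral_edge Q a b x y : is_polytope Q -> planar Q ->
  uniq [:: a; b; x; y] -> (forall v, is_vertex Q v <-> v \in [:: a; b; x; y]) ->
  adjacent Q a b -> adjacent Q a x \/ adjacent Q a y.
Proof.
move=> pQ [nn nn0 hn] uQ vQ aab.
have va : is_vertex Q a by apply/vQ; rewrite !inE eqxx.
have vb : is_vertex Q b by apply/vQ; rewrite !inE eqxx ?orbT.
have vx : is_vertex Q x by apply/vQ; rewrite !inE eqxx ?orbT.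
have vy : is_vertex Q y by apply/vQ; rewrite !inE eqxx ?orbT.
have /adjacentP[ab [c /esym ce]] := aab.
have fa : face Q c a by rewrite /face ce; exact: segmentl.
have fb : face Q c b by rewrite /face ce; exact: segmentr.
have Qa := fa.1; have Qb := fb.1.
have Qx := vertex_mem vx; have Qy := vertex_mem vy.
have cab : dotv c b = dotv c a by apply/(face_eqval fa).
have cw w : is_vertex Q w -> w != a -> w != b -> dotv c w < dotv c a.
  move=> vw wa wb; have Qw := vertex_mem vw.
  rewrite lt_neqAle fa.2 // andbT; apply/eqP => /(face_eqval fa Qw).
  rewrite /face ce => sw.
  have /segment_vertexP[] : is_vertex (segment a b) w.
  - by apply: (vertex_subset _ vw sw); rewrite -ce; exact: face_sub.
  - by apply/eqP.
  - by apply/eqP.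
have [_ [d hd]] := vertexP va.
have key p q : uniq [:: a; b; p; q] ->
    (forall v, is_vertex Q v <-> v \in [:: a; b; p; q]) ->
    (dotv d a - dotv d p) / (dotv c a - dotv c p) <=
    (dotv d a - dotv d q) / (dotv c a - dotv c q) -> adjacent Q a p.
  move=> {vx vy Qx Qy uQ vQ} + vQ.
  rewrite /= !inE !negb_or -!andbA => /and4P[_ ap aq].
  move=> /and4P[bp bq pq _].
  have vp : is_vertex Q p by apply/vQ; rewrite !inE eqxx ?orbT.
  have vq : is_vertex Q q by apply/vQ; rewrite !inE eqxx ?orbT.
  have Qp := vertex_mem vp; have Qq := vertex_mem vq.
  have cp : 0 < dotv c a - dotv c p by rewrite subr_gt0 cw // eq_sym.
  have cq : 0 < dotv c a - dotv c q by rewrite subr_gt0 cw // eq_sym.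
  set r := _ / _ => hr.
  pose f := d - r *: c.
  have fp : dotv f p = dotv f a.
    have : r * (dotv c a - dotv c p) = dotv d a - dotv d p.
      by rewrite /r divfK // gt_eqF.
    by rewrite /f !dotvE; lra.
  have fq : dotv f q <= dotv f a.
    by move: hr; rewrite ler_pdivlMr // /f !dotvE; lra.
  have fbl : dotv f b < dotv f a.
    have := hd b Qb; rewrite eq_sym ab => /(_ isT).
    by rewrite /f !dotvE cab; lra.
  have ffa : face Q f a.
    split=> //; have [s [eQ hs]] := polytope_vertices pQ.
    rewrite eQ; apply: conv_hull_le => z /hs/vQ.
    rewrite !inE => /or4P[] /eqP-> //; first exact: ltW.
    by rewrite fp.
  have ffp : face Q f p by apply/(face_eqval ffa).
  have nfq : dotv f q != dotv f a.
    apply/eqP => fq'.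
    have fba : dotv f (b - a) != 0 by rewrite dotvDr dotvNr subr_eq0 lt_eqF.
    have nE z : Q z -> dotv nn (z - a) = 0.
      by move=> Qz; rewrite !dotvE (hn _ _ Qz Qa) subrr.
    pose g := cross nn f.
    have g0 : g != 0 by apply: (cross_neq0 (w := b - a)) => //; exact: nE.
    pose lam z := dotv g (z - a) / dotv g g.
    have gE z : Q z -> dotv f z = dotv f a -> z = a + lam z *: g.
      move=> Qz fz; rewrite /lam; have fz0 : dotv f (z - a) = 0 by rewrite dotvDr dotvNr fz subrr.
      rewrite mulrC -scalerA -(cross_span (nE z Qz) fz0) scalerA mulVf ?scale1r.
        by rewrite addrC subrK.
      by rewrite dotvv_eq0.
    have pE := gE p Qp fp; have qE := gE q Qq fq'.
    apply: (@vertices_not_collinear _ _ Q a g (lam p) (lam q)) => //.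
    - by rewrite -pE.
    - by rewrite -qE.
    apply/and3P; split.
    - by apply: contra_neq ap => e; rewrite pE e scale0r addr0.
    - by apply: contra_neq aq => e; rewrite qE e scale0r addr0.
    - by apply: contra_neq pq => e; rewrite pE qE e.
  apply/adjacentP; split; first by [].
  exists f; rewrite -/(face _ _); symmetry; apply: face_segment => // z /vQ.
  rewrite !inE => /or4P[] /eqP-> fz; [by left| |by right|].
  - by have /(face_eqval ffa Qb)/eqP := fz; rewrite lt_eqF.
  - by have /(face_eqval ffa Qq)/eqP := fz; rewrite (negPf nfq).
have [h|h] := leP ((dotv d a - dotv d x) / (dotv c a - dotv c x))
    ((dotv d a - dotv d y) / (dotv c a - dotv c y)).
  by left; apply: (key x y).
right; apply: (key y x); last exact: ltW.
  move: uQ; rewrite /= !inE !negb_or (eq_sym y x) -!andbA.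
  by move=> /and4P[-> -> -> /and4P[-> -> -> _]].
by move=> v; rewrite vQ !inE; split; case/or4P => ->; rewrite ?orbT.
Qed.

(** By [quadrilateral_edge] each of the four vertices is joined to the opposite
    edge; whichever ends are reached, two disjoint sides are found. *)
Lemma quadrilateral_sides Q a b x y : is_polytope Q -> planar Q ->
  is_quadrilateral Q a b x y ->
  (adjacent Q a x /\ adjacent Q b y) \/ (adjacent Q a y /\ adjacent Q b x).
Proof.
move=> pQ plQ [uQ vQ eab exy].
have h p : perm_eq p [:: a; b; x; y] ->
    uniq p /\ forall v, is_vertex Q v <-> v \in p.
  by move=> e; rewrite (perm_uniq e); split=> // v; rewrite (perm_mem e).
have [u1 v1] : uniq [:: b; a; x; y] /\ forall v, is_vertex Q v <-> v \in [:: b; a; x; y].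
  by apply: h; rewrite -(cat1s b) -(cat1s a) perm_catCA.
have [u2 v2] : uniq [:: x; y; a; b] /\ forall v, is_vertex Q v <-> v \in [:: x; y; a; b].
  by apply: h; rewrite (perm_catC [:: x; y] [:: a; b]).
have [u3 v3] : uniq [:: y; x; a; b] /\ forall v, is_vertex Q v <-> v \in [:: y; x; a; b].
  by apply: h; rewrite -(perm_catC [:: a; b] [:: y; x]) !perm_cons (perm_catC [:: y] [:: x]).
have eba := adjacentC eab; have eyx := adjacentC exy.
have hx := quadrilateral_edge pQ plQ u2 v2 exy.
have hy := quadrilateral_edge pQ plQ u3 v3 eyx.
have [ax|ay] := quadrilateral_edge pQ plQ uQ vQ eab.
  have [bx|by_] := quadrilateral_edge pQ plQ u1 v1 eba; last by left.
  by case: hy => /adjacentC; [right|left].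
have [bx|by_] := quadrilateral_edge pQ plQ u1 v1 eba; first by right.
by case: hx => /adjacentC; [left|right].
Qed.

End Space.

(** * Regular polygons *)

Section Ngon.
Context {R : realType}.
Context {n : nat} {x y r th : R} (n0 : (0 < n)%N) (r0 : 0 < r).
Local Notation a := (ngon n x y r th).

Lemma ngon_period i : a (i + n) = a i.
Proof.
have e : th + (i + n)%:R * (2 * pi) / n%:R = th + i%:R * (2 * pi) / n%:R + pi *+ 2.
  by rewrite natrD -mulr_natl; field; rewrite pnatr_eq0 -lt0n.
by rewrite /ngon e cosD2pi sinD2pi.
Qed.

Lemma ngon_mod i : a (i %% n) = a i.
Proof.
rewrite [in RHS](divn_eq i n) addnC; elim: (i %/ n)%N => [|m IH].
  by rewrite mul0n addn0.
by rewrite mulSn addnCA addnC ngon_period.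
Qed.

(** If two vertices agree, the cosine of the difference of their angles is 1, so
    that the sine of half this difference is 0; but this half is strictly
    between 0 and [pi] for distinct residues. *)
Lemma ngon_inj i j : a i = a j <-> i = j %[mod n].
Proof.
split=> [|e]; last by rewrite -(ngon_mod i) -(ngon_mod j) e.
rewrite -(ngon_mod i) -(ngon_mod j).
have : (i %% n < n)%N by rewrite ltn_mod.
have : (j %% n < n)%N by rewrite ltn_mod.
move: (i %% n)%N (j %% n)%N => {}i {}j.
wlog ij : i j / (j < i)%N => [hw jn ji e|].
  case: (ltngtP i j) => // ij; last exact: hw.
  by apply/esym/hw.
move=> _ ji e; exfalso.
have /(congr1 (fun p : 'rV_3 => p 0 0)) := e.
have /(congr1 (fun p : 'rV_3 => p 0 1)) := e.
rewrite /= /ngon !mkptE => /addrI /(mulfI (lt0r_neq0 r0)) es.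
move=> /addrI /(mulfI (lt0r_neq0 r0)) ec.
set A := th + i%:R * _ / _ in es ec; set B := th + j%:R * _ / _ in es ec.
have : cos (A - B) = 1.
  by rewrite cosB ec es -!expr2 cos2Dsin2.
pose h : R := (i - j)%:R * pi / n%:R.
have -> : A - B = h *+ 2.
  rewrite /A /B /h natrB 1?ltnW // -mulr_natl; field.
  by rewrite pnatr_eq0 -lt0n.
rewrite cos_mulr2n mulr2n => ch.
have hs : 0 < sin h.
  apply: sin_gt0_pi; rewrite /h !divr_gt0 ?mulr_gt0 ?pi_gt0 ?ltr0n ?subn_gt0 //=.
  rewrite ltr_pdivrMr ?ltr0n // mulrC ltr_pM2l ?pi_gt0 // ltr_nat.
  exact: leq_ltn_trans (leq_subr _ _) ji.
have := cos2Dsin2 h; nra.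
Qed.

End Ngon.

(** The pigeonhole principle, for a set whose cardinality is known through a
    bijection. *)
Lemma surjective_card_inj (X : Type) (V : set X) (N : nat) (f : nat -> X) :
  (V #= `I_N)%card -> (forall v, V v -> exists2 m, (m < N)%N & f m = v) ->
  forall m m', (m < N)%N -> (m' < N)%N -> f m = f m' -> m = m'.
Proof.
move=> /card_set_bijP[g [_ _ gsurj]] fsurj m m' mN m'N e.
have : uniq (mkseq (g \o f) N).
  apply: (@leq_size_uniq _ (iota 0 N)); rewrite ?iota_uniq ?size_mkseq ?size_iota //.
  move=> y; rewrite mem_iota /= add0n => yN.
  have [v Vv gv] := gsurj y yN; have [x xN fx] := fsurj v Vv.
  by apply/mapP; exists x; rewrite ?mem_iota //= fx gv.
by move=> /mkseq_uniqP; apply; rewrite ?inE //= e.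
Qed.

(** * Minkowski sums with a vertical segment *)

Definition signed {R : realType} (s : bool) (x : R) := if s then 0 < x else x < 0.

Section VerticalSum.
Context {R : realType}.
Local Notation pt := 'rV[R]_3.
Implicit Types (u v x y f : pt) (P : set pt) (s : bool).

(** A sum is maximal for a form exactly when both of its terms are. *)
Lemma face_minkowski (A B : set pt) f :
  face (minkowski_sum A B) f = minkowski_sum (face A f) (face B f).
Proof.
apply/seteqP; split=> [_ [[x Ax [y By <-]] h]|_ [x fx [y fy <-]]].
  exists x.
    split=> // x' Ax'; rewrite -(lerD2r (dotv f y)) -!dotvDr.
    by apply: h; exists x' => //; exists y.
  exists y => //; split=> // y' By'; rewrite -(lerD2l (dotv f x)) -!dotvDr.
  by apply: h; exists x => //; exists y'.
split; first by exists x; [exact: fx.1|exists y => //; exact: fy.1].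
by move=> _ [x' Ax' [y' By' <-]]; rewrite !dotvDr lerD ?fx.2 ?fy.2.
Qed.

Lemma minkowski_set1 (A : set pt) y : minkowski_sum A [set y] = [set x + y | x in A].
Proof.
apply/seteqP; split=> [_ [x Ax [_ -> <-]]|_ [x Ax <-]]; first by exists x.
by exists x => //; exists y.
Qed.

Lemma segment_translate u v y :
  [set x + y | x in segment u v] = segment (u + y) (v + y).
Proof.
have e t : (1 - t) *: u + t *: v + y = (1 - t) *: (u + y) + t *: (v + y).
  by apply/rowP => i; rewrite !mxE; ring.
apply/seteqP; split=> [_ [_ [t t01 <-] <-]|_ [t t01 <-]].
  by exists t.
by exists ((1 - t) *: u + t *: v); [exists t|].
Qed.

Lemma face_segment_lt u v f : dotv f u < dotv f v -> face (segment u v) f = [set v].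
Proof.
move=> uv; rewrite segment_hull (@conv_hull_faceP _ _ _ _ v).
- rewrite -[RHS]conv_hull1; congr (conv_hull _); apply/seteqP; split=> x /=.
    by move=> [[->|->//] e]; move: uv; rewrite e ltxx.
  by move=> ->; split=> //; right.
- by apply: sub_conv_hull; right.
- by move=> x [->|->//]; exact: ltW.
Qed.

Lemma face_segment_eq u v f : dotv f u = dotv f v -> face (segment u v) f = segment u v.
Proof.
move=> uv; apply/seteqP; split=> [x []//|x sx]; split=> // y sy.
have h z : segment u v z -> dotv f z = dotv f v.
  by move=> [t _ <-]; rewrite !dotvE uv; ring.
by rewrite !h.
Qed.

Lemma translate_inj (A B : set pt) y :
  [set x + y | x in A] = [set x + y | x in B] -> A = B.
Proof.
move=> e; have h (C D : set pt) : [set x + y | x in C] = [set x + y | x in D] -> C `<=` D.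
  move=> e' x Cx; have : [set x + y | x in C] (x + y) by exists x.
  by rewrite e' => -[x' Dx' /addIr <-].
by apply/seteqP; split; apply: h.
Qed.

Context {lo hi : pt} (xlh : xcoord lo = xcoord hi) (ylh : ycoord lo = ycoord hi)
  (zlh : zcoord lo < zcoord hi).
Local Notation Sigma := (segment lo hi).
Definition endpoint s := if s then hi else lo.

Lemma dotv_vertical f : dotv f hi = dotv f lo + zcoord f * (zcoord hi - zcoord lo).
Proof.
move: xlh ylh; rewrite !dotv3 /xcoord /ycoord /zcoord => -> ->; ring.
Qed.

(** A form that increases upwards is maximal on a vertical segment at its top
    only. *)
Lemma face_sum_signed P s f : signed s (zcoord f) ->
  face (minkowski_sum P Sigma) f = [set x + endpoint s | x in face P f].
Proof.
move=> sf; rewrite face_minkowski (_ : face Sigma f = [set endpoint s]).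
  exact: minkowski_set1.
case: s sf => /= sf; last rewrite segmentC; apply: face_segment_lt.
  by rewrite dotv_vertical ltrDl mulr_gt0 ?subr_gt0.
by rewrite dotv_vertical gtrDl nmulr_rlt0 ?subr_gt0.
Qed.

Lemma face_sum_horizontal P f : zcoord f = 0 ->
  face (minkowski_sum P Sigma) f = minkowski_sum (face P f) Sigma.
Proof.
move=> f0; rewrite face_minkowski (_ : face Sigma f = Sigma) //.
by apply: face_segment_eq; rewrite dotv_vertical f0 mul0r addr0.
Qed.

Lemma signedP (z : R) : z = 0 \/ exists s, signed s z.
Proof.
have [h|h|->] := ltgtP z 0; [|by right; exists true|by left].
by right; exists false.
Qed.

Lemma adjacent_sum P s u v f : signed s (zcoord f) -> u != v ->
  face P f = segment u v ->
  adjacent (minkowski_sum P Sigma) (u + endpoint s) (v + endpoint s).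
Proof.
move=> sf uv e; apply/adjacentP; split; first by rewrite (inj_eq (addIr _)).
exists f; rewrite -/(face _ _) (face_sum_signed _ sf) e.
by rewrite segment_translate.
Qed.

Lemma vertex_sum P s v f : signed s (zcoord f) -> face P f = [set v] ->
  is_vertex (minkowski_sum P Sigma) (v + endpoint s).
Proof.
move=> sf e; exists f; rewrite -/(face _ _) (face_sum_signed _ sf) e.
by rewrite image_set1.
Qed.

Lemma adjacent_sum_vertical P v f : zcoord f = 0 -> face P f = [set v] ->
  adjacent (minkowski_sum P Sigma) (v + lo) (v + hi).
Proof.
move=> f0 e; apply/adjacentP; split.
  by rewrite (inj_eq (addrI _)); apply: contraTneq zlh => ->; rewrite ltxx.
exists f; rewrite -/(face _ _) (face_sum_horizontal _ f0) e.
rewrite addrC (addrC v) -segment_translate -minkowski_set1.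
apply/seteqP; split=> [_ [x sx [_ -> <-]]|_ [_ -> [x sx <-]]].
  by exists v => //; exists x => //; rewrite addrC.
by exists x => //; exists v => //; rewrite addrC.
Qed.

Lemma vertex_sum_cases P x : is_vertex (minkowski_sum P Sigma) x ->
  exists s v f, [/\ x = v + endpoint s, signed s (zcoord f) & face P f = [set v]].
Proof.
move=> [f e]; have [f0|[s sf]] := signedP (zcoord f).
  move: e; rewrite -/(face _ _) (face_sum_horizontal _ f0) => e.
  have [y fy _] : minkowski_sum (face P f) Sigma x by rewrite -e.
  have h z : Sigma z -> y + z = x.
    by move=> sz; have : [set x] (y + z) by rewrite e; exists y => //; exists z.
  have /addrI lh : y + lo = y + hi by rewrite !h //; [exact: segmentr|exact: segmentl].
  by move: zlh; rewrite lh ltxx.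
move: e; rewrite -/(face _ _) (face_sum_signed _ sf) => e.
have [v fv ev] : [set x + endpoint s | x in face P f] x by rewrite -e.
exists s, v, f; split=> //; apply: (@translate_inj _ _ (endpoint s)).
by rewrite -e -ev image_set1.
Qed.

Lemma adjacent_sum_cases P x y : adjacent (minkowski_sum P Sigma) x y ->
  (exists s u v f, [/\ x = u + endpoint s, y = v + endpoint s,
    signed s (zcoord f), u != v & face P f = segment u v]) \/
  (exists f, zcoord f = 0 /\ segment x y = minkowski_sum (face P f) Sigma).
Proof.
move=> /adjacentP[xy [f e]]; have [f0|[s sf]] := signedP (zcoord f).
  by right; exists f; split=> //; rewrite e -/(face _ _) face_sum_horizontal.
left; exists s, (x - endpoint s), (y - endpoint s), f.
split; rewrite ?subrK ?(inj_eq (addIr _)) //.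
apply: (@translate_inj _ _ (endpoint s)).
by rewrite segment_translate !subrK -face_sum_signed // e.
Qed.

End VerticalSum.

(** * Walks and diameters *)

Section Walks.
Context {R : realType} {n : nat}.
Local Notation pt := 'rV[R]_n.
Implicit Types (u v w : pt) (P : set pt) (m : nat).

Definition within P u v m := exists2 m', (m' <= m)%N & walk P u v m'.

Lemma within_leq P u v m m' : within P u v m -> (m <= m')%N -> within P u v m'.
Proof. by move=> [j jm w] mm'; exists j => //; exact: leq_trans mm'. Qed.

Lemma within_refl P u m : within P u u m.
Proof. by exists 0%N => //; exists (fun=> u). Qed.

Lemma within_adjacent P u v : adjacent P u v -> within P u v 1.
Proof.
move=> auv; exists 1%N => //; exists (fun i => if i is 0 then u else v).
by split=> // -[].
Qed.

(** The walks are concatenated at index [j]; both branches agree there. *)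
Lemma within_trans P u v w m m' :
  within P u v m -> within P v w m' -> within P u w (m + m').
Proof.
move=> [j jm [p [p0 pj hp]]] [j' jm' [q [q0 qj hq]]].
exists (j + j')%N; first exact: leq_add.
exists (fun i => if (i < j)%N then p i else q (i - j)%N); split.
- case: ltnP => // j0; move: j0 pj; rewrite leqn0 => /eqP -> pj.
  by rewrite q0 -pj p0.
- by rewrite ltnNge leq_addr /= addKn.
- move=> i ij; have [ij1|ij1] := ltnP i j; last first.
    rewrite ltnNge (leq_trans ij1 (leqnSn i)) /= subSn //; apply: hq; lia.
  case: ltnP => ij2; first exact: hp.
  have -> : i.+1 = j by lia.
  by rewrite subnn q0 -pj (_ : j = i.+1); [exact: hp|lia].
Qed.

Lemma within_sym P u v m : within P u v m -> within P v u m.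
Proof.
move=> [j jm [p [p0 pj hp]]]; exists j => //; exists (fun i => p (j - i)%N); split.
- by rewrite subn0.
- by rewrite subnn.
- move=> i ij; apply: adjacentC; rewrite (_ : (j - i)%N = (j - i.+1).+1); last by lia.
  by apply: hp; lia.
Qed.

(** The quantity [h] is a relation, as it is defined only at some points. *)
Lemma walk_variation P K (h : pt -> nat -> Prop) u v m n0 n1 :
  (forall w i i', h w i -> h w i' -> i = i') ->
  (forall w w', adjacent P w w' -> exists i i', [/\ h w i, h w' i' & (i' <= i + K)%N]) ->
  walk P u v m -> h u n0 -> h v n1 -> (n1 <= n0 + K * m)%N.
Proof.
move=> hf hl [p [p0 pm hp]] hu hv.
suff H i : (i <= m)%N -> forall j, h (p i) j -> (j <= n0 + K * i)%N.
  by apply: (H m) => //; rewrite pm.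
elim: i => [_ j|i IH im j hj].
  by rewrite p0 muln0 addn0 => /(hf _ _ _ hu) ->.
have [i1 [i2 [h1 h2 le]]] := hl _ _ (hp i im).
by rewrite (hf _ _ _ hj h2); have := IH (ltnW im) _ h1; lia.
Qed.

Section Diameter.
Context {P : set pt} {M : nat}
  (diamP : forall u v, is_vertex P u -> is_vertex P v -> within P u v M).
Local Open Scope ereal_scope.

Let D := [set graph_dist P uv.1 uv.2 |
  uv in [set uv : pt * pt | is_vertex P uv.1 /\ is_vertex P uv.2]].

Let D_le : ereal_sup D <= (M%:R)%:E.
Proof.
apply: ge_ereal_sup => _ [[u v] /= [vu vv] <-].
have [m mM w] := diamP vu vv.
apply: (@le_trans _ _ (m%:R)%:E); last by rewrite lee_fin ler_nat.
by apply: ereal_inf_lbound; exists m.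
Qed.

Lemma diameter_ge N u v : is_vertex P u -> is_vertex P v ->
  (forall m, walk P u v m -> (N <= m)%N) -> (N%:R <= diameter P)%R.
Proof.
move=> vu vv h.
have D_ge : (N%:R)%:E <= ereal_sup D.
  apply: (@le_trans _ _ (graph_dist P u v)).
    by apply: le_ereal_inf_tmp => _ [m /h Nm <-]; rewrite lee_fin ler_nat.
  by apply: ereal_sup_ubound; exists (u, v).
rewrite /diameter -/D -lee_fin fineK //.
by rewrite fin_numE; apply/andP; split; apply/eqP => e; move: D_ge D_le; rewrite e.
Qed.

Lemma diameter_le u : is_vertex P u -> (diameter P <= M%:R)%R.
Proof.
move=> vu.
have D_ge : 0 <= ereal_sup D.
  apply: (@le_trans _ _ (graph_dist P u u)).
    by apply: le_ereal_inf_tmp => _ [m _ <-]; rewrite lee_fin ler0n.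
  by apply: ereal_sup_ubound; exists (u, u).
rewrite /diameter -/D -lee_fin fineK //.
by rewrite fin_numE; apply/andP; split; apply/eqP => e; move: D_ge D_le; rewrite e.
Qed.

End Diameter.
End Walks.

(** The distance from [x] to 0 on the cycle of length [N]. *)
Definition cyclic_norm N x := minn (x %% N) (N - x %% N).

Lemma cyclic_norm_lipschitz N x y K : (0 < N)%N -> (x <= y + K)%N -> (y <= x + K)%N ->
  (cyclic_norm N y <= cyclic_norm N x + K)%N.
Proof.
move=> N0.
have step m : (cyclic_norm N m.+1 <= (cyclic_norm N m).+1)%N /\
              (cyclic_norm N m <= (cyclic_norm N m.+1).+1)%N.
  have mN : (m %% N < N)%N by rewrite ltn_mod.
  rewrite /cyclic_norm modnS; case: ifP => [dv|_]; last by lia.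
  have -> : (m %% N = N.-1)%N.
    have := modnS m N; rewrite dv => h; apply/eqP; rewrite eqn_leq.
    have : (N %| (m %% N).+1)%N by rewrite -addn1 /dvdn modnDml addn1.
    by move=> /dvdn_leq => /(_ isT); lia.
  by split; lia.
have steps m d : (cyclic_norm N (m + d) <= cyclic_norm N m + d)%N /\
                 (cyclic_norm N m <= cyclic_norm N (m + d) + d)%N.
  elim: d => [|d [IH1 IH2]]; first by rewrite !addn0.
  by have [h1 h2] := step (m + d)%N; rewrite addnS; split; lia.
move=> xy yx; have [le|/ltnW le] := leqP x y.
  by have [h _] := steps x (y - x)%N; rewrite subnKC // in h; lia.
by have [_ h] := steps y (x - y)%N; rewrite subnKC // in h; lia.
Qed.

(** * The edges of Xi *)

Section XiGraph.
Context {R : realType}.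
Local Notation pt := 'rV[R]_3.
Context {k l : nat} {P : set pt} {a : nat -> pt} {c : nat -> nat -> pt}
  {T : bool -> set pt} {Q : nat -> nat -> set pt} {t : nat -> pt}.
Context (S : Xi_spec k l P a c T Q t) (k2 : (2 <= k)%N) (l2 : (2 <= l)%N).
Implicit Types (p u v w n : pt) (s : bool).

(** The edges of the polygon have indices from 1 to [2 * k], used cyclically:
    [ix i] is the index congruent to [i], through which the data are extended to
    all natural numbers below. *)
Definition ix i := ((i + k.*2.-1) %% k.*2).+1.
Arguments ix : simpl never.

Lemma edge_ix i : edge_index k (ix i).
Proof. by rewrite /edge_index /ix /= ltn_mod double_gt0; lia. Qed.

Lemma ix_id i : edge_index k i -> ix i = i.
Proof.
move=> /andP[i0 ik]; rewrite /ix (_ : i + _ = i.-1 + k.*2)%N; last by lia.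
by rewrite modnDr modn_small; lia.
Qed.

Lemma ix_eq i j : ix i = ix j <-> i = j %[mod k.*2].
Proof.
rewrite /ix; split=> [[/eqP]|/eqP].
  by rewrite eqn_modDr => /eqP.
by rewrite -(eqn_modDr k.*2.-1) => /eqP ->.
Qed.

Lemma ix_modl i : ix i = i %[mod k.*2].
Proof.
rewrite /ix -addn1 modnDml (_ : i + _ + 1 = i + k.*2)%N; last by lia.
by rewrite modnDr.
Qed.

Lemma odd_mod i j : i = j %[mod k.*2] -> odd i = odd j.
Proof.
have h m : odd (m %% k.*2) = odd m.
  by rewrite [in RHS](divn_eq m k.*2) oddD oddM odd_double andbF.
by rewrite -[odd i]h => ->; rewrite h.
Qed.

Lemma odd_ix i : odd (ix i) = odd i.
Proof. exact/odd_mod/ix_modl. Qed.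

Lemma a_inj i j : a i = a j <-> i = j %[mod k.*2].
Proof.
have [x [y [r [th [r0 ->]]]]] := Xi_regular S.
by apply: ngon_inj => //; lia.
Qed.

Lemma a_ix i : a (ix i) = a i.
Proof. exact/a_inj/ix_modl. Qed.

Lemma a_ixS i : a (ix i).+1 = a i.+1.
Proof. by apply/a_inj; rewrite -addn1 -modnDml ix_modl modnDml addn1. Qed.

Lemma aS_neq i : a i != a i.+1.
Proof.
apply/eqP => /a_inj /eqP; rewrite -addn1 -[X in X == _ %[mod _]]addn0 eqn_modDl.
by rewrite !modn_small; lia.
Qed.

Lemma zcoord_a i : zcoord (a i) = 0.
Proof.
by have [x [y [r [th [r0 ->]]]]] := Xi_regular S; rewrite /zcoord mkptE.
Qed.

Definition chain i j := c (ix i) j.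
Definition wall i := facet_F l c (ix i).
Definition qface i j := Q (ix i) j.
Definition apex i := t (ix i).
Definition tri i : set pt := facet_D a t (ix i).

Lemma chain_mod i i' j : i = i' %[mod k.*2] -> chain i j = chain i' j.
Proof. by move/ix_eq; rewrite /chain => ->. Qed.

Lemma chain0 i : chain i 0 = a i.
Proof. by rewrite /chain (Xi_chain_ends S (edge_ix i)).1 a_ix. Qed.

Lemma chainl i : chain i l = a i.+1.
Proof. by rewrite /chain (Xi_chain_ends S (edge_ix i)).2 a_ixS. Qed.

Let pP : is_polytope P := Xi_polytope S.

Lemma vertex_a i : is_vertex P (a i).
Proof.
by apply/(Xi_vertices S); apply: Or31; exists (ix i); rewrite ?a_ix //; exact: edge_ix.
Qed.

Lemma vertex_chain i j : (j <= l)%N -> is_vertex P (chain i j).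
Proof.
move=> jl; have [->|j0] := posnP j; first by rewrite chain0; exact: vertex_a.
have [->|jl'] := eqVneq j l; first by rewrite chainl; exact: vertex_a.
apply/(Xi_vertices S); apply: Or32; exists (ix i), j; split=> //.
  exact: edge_ix.
by rewrite j0 ltn_neqAle jl' jl.
Qed.

Lemma facet_T s : is_facet P (T s).
Proof. by apply/(Xi_facets S); apply: Or41; exists s. Qed.

Lemma facet_wall i : is_facet P (wall i).
Proof. by apply/(Xi_facets S); apply: Or42; exists (ix i) => //; exact: edge_ix. Qed.

Lemma facet_qface i j : (j < l)%N -> is_facet P (qface i j).
Proof.
by move=> jl; apply/(Xi_facets S); apply: Or43; exists (ix i), j; split=> //; exact: edge_ix.
Qed.

Variant facet_spec (G : set pt) : Prop :=
| FacetT s of G = T s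
| FacetWall i of G = wall i
| FacetQface i j of (j < l)%N & G = qface i j
| FacetTri i of G = tri i.

Lemma facet_cases G : is_facet P G -> facet_spec G.
Proof.
move=> /(Xi_facets S)[[s ->]|[i ei ->]|[i [j [ei jl ->]]]|[i ei ->]].
- exact: (@FacetT _ s).
- by apply: (@FacetWall _ i); rewrite /wall ix_id.
- by apply: (@FacetQface _ i j); rewrite /qface ?ix_id.
- by apply: (@FacetTri _ i); rewrite /tri ix_id.
Qed.

Lemma signed_neq0 s (x : R) : signed s x -> x != 0.
Proof. by case: s => h; [rewrite gt_eqF|rewrite lt_eqF]. Qed.

Lemma signed_inj s s' (x : R) : signed s x -> signed s' x -> s = s'.
Proof. by case: s s' => -[] //= h h'; have := lt_trans h h'; rewrite ltxx. Qed.

Lemma signed_chain i j : (0 < j < l)%N -> signed (odd i) (zcoord (chain i j)).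
Proof.
move=> jl; have [_] := Xi_colored S (edge_ix i) jl.
by rewrite odd_ix.
Qed.

Lemma open_chain i j : (0 < j < l)%N -> open_segment (a i) (a i.+1) (proj (chain i j)).
Proof. by move=> jl; have [] := Xi_colored S (edge_ix i) jl; rewrite a_ix a_ixS. Qed.

(** A horizontal facet is beyond the coloured vertices of its side, hence beyond
    the plane of the polygon and the coloured vertices of the other side. *)
Lemma T_height s : exists2 h, signed s h & (forall p, T s p -> zcoord p = h) /\
  (forall i j, (j <= l)%N -> if s then zcoord (chain i j) < h else h < zcoord (chain i j)).
Proof.
have [h [hT hc]] := Xi_T_horizontal S s.
have C1 i : odd i = s -> if s then zcoord (chain i 1) < h else h < zcoord (chain i 1).
  by move=> oi; apply: hc; rewrite ?odd_ix ?edge_ix ?l2.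
have hs : signed s h.
  have := @signed_chain s 1; rewrite l2 => /(_ isT); have := C1 s.
  by rewrite oddb => /(_ erefl); case: (s) => /= h1 h2; lra.
exists h => //; split=> // i j jl.
have sC : (zcoord (chain i j) == 0) || signed (odd i) (zcoord (chain i j)) && (0 < j < l)%N.
  have [->|j0] := posnP j; first by rewrite chain0 zcoord_a eqxx.
  have [->|jl'] := eqVneq j l; first by rewrite chainl zcoord_a eqxx.
  have h1 : (0 < j < l)%N by rewrite j0 ltn_neqAle jl' jl.
  by rewrite (signed_chain i h1) ltn_neqAle jl' jl orbT.
case/orP: sC => [/eqP->|/andP[h1 jl1]]; first by case: (s) hs.
have [oi|oi] := eqVneq (odd i) s.
  by apply: hc; rewrite ?odd_ix ?edge_ix.
by case: (s) (odd i) oi hs h1 => -[] //= _ h2 h3; lra.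
Qed.

Lemma signed_T s p : T s p -> signed s (zcoord p).
Proof. by have [h hs [hT _]] := T_height s => /hT ->. Qed.

Lemma T_inj s s' p : T s p -> T s' p -> s = s'.
Proof. by move=> /signed_T h /signed_T; exact: signed_inj. Qed.

Lemma chain_notin_T s i j : (j <= l)%N -> ~ T s (chain i j).
Proof.
move=> jl; have [h _ [hT hC]] := T_height s => /hT e.
by have := hC i j jl; rewrite e ltxx; case: (s).
Qed.

Lemma vertex_T s w : is_vertex (T s) w -> is_vertex P w.
Proof. by move=> vw; apply/(Xi_vertices S); apply: Or33; exists s. Qed.

Lemma chain_neq_T s i j w : (j <= l)%N -> is_vertex (T s) w -> chain i j != w.
Proof.
by move=> jl vw; apply/eqP => e; apply: (@chain_notin_T s i j jl); rewrite e; exact: vertex_mem.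
Qed.

Variant vertex_spec v : Prop :=
| VertexChain i j of (j < l)%N & v = chain i j
| VertexT s of is_vertex (T s) v.

Lemma vertex_cases v : is_vertex P v -> vertex_spec v.
Proof.
move=> /(Xi_vertices S)[[i ei ->]|[i [j [ei /andP[j0 jl] ->]]]|[s vs]].
- by apply: (@VertexChain _ i 0); [lia|rewrite chain0].
- by apply: (@VertexChain _ i j); rewrite ?/chain ?ix_id.
- exact: (@VertexT _ s).
Qed.

Lemma facet_vertex G v : is_facet P G -> is_vertex P v -> G v -> is_vertex G v.
Proof.
move=> [[d ->] _] vv Gv; apply: (vertex_subset _ vv Gv); exact: face_sub.
Qed.

Lemma vertex_wall i v : is_vertex (wall i) v <-> exists2 j, (j <= l)%N & v = chain i j.
Proof. exact: (Xi_F_vertices S (edge_ix i)). Qed.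

Lemma chain_in_wall i j : (j <= l)%N -> wall i (chain i j).
Proof. by move=> jl; apply: vertex_mem; apply/vertex_wall; exists j. Qed.

Lemma wall_cases i v : is_vertex P v -> wall i v -> exists2 j, (j <= l)%N & v = chain i j.
Proof. by move=> vv Fv; apply/vertex_wall/facet_vertex => //; exact: facet_wall. Qed.

Lemma dotv_proj n p : dotv n p = dotv n (proj p) + zcoord n * zcoord p.
Proof. by rewrite !dotv3 /proj /xcoord /ycoord /zcoord !mkptE; ring. Qed.

Lemma proj_id p : zcoord p = 0 -> proj p = p.
Proof. by move=> z0; apply: eq_row3; rewrite /proj /xcoord /ycoord !mkptE. Qed.

Lemma proj_hull p : P p ->
  conv_hull [set a i | i in [set i | edge_index k i]] (proj p).
Proof. by move=> Pp; rewrite -(Xi_proj S); exists p. Qed.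

Lemma Xi_conv : conv_closed P.
Proof. exact: polytope_conv. Qed.

Lemma proj_in p : P p -> P (proj p).
Proof.
move=> /proj_hull; apply: (conv_hull_min Xi_conv) => _ [i _ <-].
exact: vertex_mem (vertex_a i).
Qed.

Lemma dotv_open_segment n u v p : open_segment u v p -> dotv n u <= dotv n p ->
  dotv n v <= dotv n p -> dotv n u = dotv n p /\ dotv n v = dotv n p.
Proof.
by move=> [r /andP[r0 r1] <-]; rewrite !dotvE => h1 h2; split; nra.
Qed.

(** A horizontal form that is maximal at a coloured vertex is maximal at its
    projection, which is inside an edge of the polygon. *)
Lemma face_open_edge n i p : zcoord n = 0 -> face P n p ->
  open_segment (a i) (a i.+1) (proj p) -> face P n (a i) /\ face P n (a i.+1).
Proof.
move=> n0 fp op; have np : dotv n (proj p) = dotv n p by rewrite [RHS]dotv_proj n0 mul0r addr0.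
have Pa := vertex_mem (vertex_a i); have Pb := vertex_mem (vertex_a i.+1).
have [|| e1 e2] := dotv_open_segment (n := n) op; rewrite ?np ?fp.2 //.
by split; apply/(face_eqval fp) => //; rewrite ?e1 ?e2 np.
Qed.

(** The form exposing a wall is constant on [E_i], hence has the same value at a
    coloured vertex and at its projection: it does not depend on the height. *)
Lemma wall_horizontal i : exists n, zcoord n = 0 /\ wall i = face P n.
Proof.
have [n _ eF] := facetP (facet_wall i); exists n; split=> //.
have l1 : (0 < 1 < l)%N by rewrite l2.
have f0 : face P n (a i) by rewrite -eF -chain0; exact: chain_in_wall.
have fl : face P n (a i.+1) by rewrite -eF -chainl; exact: chain_in_wall.
have f1 : face P n (chain i 1) by rewrite -eF; apply: chain_in_wall; lia.
have e0 : dotv n (a i) = dotv n (chain i 1) by apply/(face_eqval f1) => //; exact: f0.1.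
have el : dotv n (a i.+1) = dotv n (chain i 1) by apply/(face_eqval f1) => //; exact: fl.1.
have [r _ er] := open_chain i l1.
have e1 : dotv n (proj (chain i 1)) = dotv n (chain i 1) by rewrite -er !dotvE e0 el; ring.
have : zcoord n * zcoord (chain i 1) = 0 by have := dotv_proj n (chain i 1); lra.
by move/eqP; rewrite mulf_eq0 (negPf (signed_neq0 (signed_chain _ l1))) orbF => /eqP.
Qed.

Lemma a_notin_open i u : ~ open_segment (a i) u (a i) \/ a i = u.
Proof.
have [|au] := eqVneq (a i) u; [by right|left=> -[r /andP[r0 r1]]].
move/eqP; rewrite -subr_eq0 (_ : _ - _ = r *: (u - a i)).
  by rewrite scaler_eq0 gt_eqF //= subr_eq0 eq_sym (negPf au).
by apply/rowP => j; rewrite !mxE; ring.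
Qed.

(** Walls being vertical, a vertex above [a i] is on [wall i], all of whose
    vertices are known. *)
Lemma above_a i v : is_vertex P v -> proj v = a i -> v = a i.
Proof.
move=> vv pv; have [n [n0 eF]] := wall_horizontal i.
have fa : face P n (a i) by rewrite -eF -chain0; exact: chain_in_wall.
have Pv := vertex_mem vv.
have : wall i v.
  rewrite eF; apply/(face_eqval fa) => //.
  by rewrite dotv_proj n0 mul0r addr0 pv.
move=> /(wall_cases vv)[j jl ev].
have [j0|j0] := posnP j; first by rewrite ev j0 chain0.
have [jl'|jl'] := eqVneq j l.
  have e : a i.+1 = a i by rewrite -pv ev jl' chainl proj_id ?zcoord_a.
  by rewrite ev jl' chainl.
have h : (0 < j < l)%N by rewrite j0 ltn_neqAle jl' jl.
have := open_chain i h; rewrite -ev pv.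
have [//|e] := a_notin_open i (a i.+1).
by have := aS_neq i; rewrite -e eqxx.
Qed.

Lemma chain_eq_a i i' j : (j <= l)%N -> a i = chain i' j -> (j = 0%N \/ j = l).
Proof.
move=> jl e; have [->|j0] := posnP j; [by left|].
have [->|jl'] := eqVneq j l; [by right|].
have h : (0 < j < l)%N by rewrite j0 ltn_neqAle jl' jl.
by have := signed_neq0 (signed_chain i' h); rewrite -e zcoord_a eqxx.
Qed.

(** If a coloured vertex is on a wall, so are its projection and the endpoints
    of the edge in which this projection lies, and two blue vertices determine
    the wall. *)
Lemma chain_inj i i' j j' : (0 < j < l)%N -> (j' <= l)%N -> chain i j = chain i' j' ->
  i = i' %[mod k.*2] /\ j = j'.
Proof.
move=> jl j'l e.
have j'l' : (0 < j' < l)%N.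
  have := signed_neq0 (signed_chain i jl); rewrite e.
  have [->|j0] := posnP j'; first by rewrite chain0 zcoord_a eqxx.
  have [->|jl'] := eqVneq j' l; first by rewrite chainl zcoord_a eqxx.
  by rewrite ltn_neqAle jl' j'l.
have [n [n0 eF]] := wall_horizontal i'.
have fC : face P n (chain i j) by rewrite e -eF; exact: chain_in_wall.
have [fa fb] := face_open_edge n0 fC (open_chain i jl).
have ends m : face P n (a m) -> m = i' %[mod k.*2] \/ m = i'.+1 %[mod k.*2].
  rewrite -eF => /(wall_cases (vertex_a m))[j1 j1l e1].
  have [j10|j11] := chain_eq_a j1l e1; move: e1.
    by rewrite j10 chain0 => /a_inj; left.
  by rewrite j11 chainl => /a_inj; right.
have ii : i = i' %[mod k.*2].
  have [//|h1] := ends _ fa; have h2 := ends _ fb.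
  have s2 : i.+1 = i'.+2 %[mod k.*2] by rewrite -addn1 -modnDml h1 modnDml addn1.
  exfalso; case: h2; rewrite s2 => /eqP.
    by rewrite -addn2 -[X in _ == X %[mod _]]addn0 eqn_modDl !modn_small; lia.
  by rewrite -addn1 -[X in _ == X %[mod _]]addn0 eqn_modDl !modn_small; lia.
split=> //; apply: (Xi_colored_distinct S (edge_ix i)) => //.
by rewrite -/(chain i j) e /chain; have /ix_eq -> := ii.
Qed.

Lemma ix_ix i : ix (ix i) = ix i.
Proof. exact/ix_eq/ix_modl. Qed.

Lemma chain_ix i j : chain (ix i) j = chain i j.
Proof. exact/chain_mod/ix_modl. Qed.

Lemma adjacent_chain i j : (j < l)%N -> adjacent P (chain i j) (chain i j.+1).
Proof.
move=> jl; apply: (adjacent_trans pP (facet_face (facet_wall i))).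
by apply/(Xi_F_edges S (edge_ix i)); right; exists j.
Qed.

Lemma adjacent_a i : adjacent P (a i) (a i.+1).
Proof.
apply: (adjacent_trans pP (facet_face (facet_wall i))).
by apply/(Xi_F_edges S (edge_ix i)); left; rewrite a_ix a_ixS.
Qed.

(** The ends [pq] of the edge of a quadrilateral on [T (odd i)], in the order in
    which they are joined to [chain i j] and to [chain i j.+1]. *)
Definition sides i j (pq : pt * pt) : Prop :=
  [/\ adjacent (T (odd i)) pq.1 pq.2, is_edge (qface i j) (segment pq.1 pq.2),
      adjacent P (chain i j) pq.1, adjacent P (chain i j.+1) pq.2 &
      forall v, is_vertex (qface i j) v <-> v \in [:: chain i j; chain i j.+1; pq.1; pq.2]].

Lemma sides_exist i j : (j < l)%N -> exists pq, sides i j pq.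
Proof.
move=> jl; have fQ := facet_qface i jl; have faQ := facet_face fQ.
have [u [v [auv qQ]]] := Xi_Q_quad S (edge_ix i) jl.
rewrite odd_ix in auv.
have [uQ vQ eC euv] := qQ.
have pQ : is_polytope (qface i j).
  apply: (is_polytope_face pP faQ (x := chain i j)).
  by apply: vertex_mem; apply/vQ; rewrite !inE eqxx.
have [[h1 h2]|[h1 h2]] := quadrilateral_sides pQ (facet_planar fQ) qQ.
  by exists (u, v); split=> //; apply: (adjacent_trans pP faQ).
exists (v, u); split=> //=; first exact: adjacentC.
- by rewrite segmentC.
- exact: (adjacent_trans pP faQ).
- exact: (adjacent_trans pP faQ).
- move=> z; rewrite vQ !inE.
  by split=> /or4P[] ->; rewrite ?orbT.
Qed.

Definition rim_ends i j : pt * pt := xget (0, 0) (sides (ix i) j).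

Lemma sidesP i j : (j < l)%N -> sides i j (rim_ends i j).
Proof.
move=> jl; have [pq h] := sides_exist (ix i) jl.
have : sides (ix i) j (rim_ends i j) by apply: xgetPex; exists pq.
by rewrite /sides odd_ix /qface ix_ix !chain_ix.
Qed.

Lemma rim_ends_mod i i' j : i = i' %[mod k.*2] -> rim_ends i j = rim_ends i' j.
Proof. by rewrite /rim_ends => /ix_eq ->. Qed.

(* only the property [sidesP] of the chosen ends is used from here on *)
Opaque rim_ends.

Lemma vertex_apex i : is_vertex (T (~~ odd i)) (apex i).
Proof. by have := Xi_D_apex S (edge_ix i); rewrite odd_ix. Qed.

Lemma polytope_T s w : T s w -> is_polytope (T s).
Proof. exact: (is_polytope_face pP (facet_face (facet_T s))). Qed.

Lemma adjacent_T s u v : adjacent (T s) u v -> is_vertex (T s) u /\ is_vertex (T s) v.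
Proof.
move=> auv; have /adjacentP[_ [n e]] := auv.
have Tu : T s u by have [] : face (T s) n u by rewrite /face -e; exact: segmentl.
have pT := polytope_T Tu.
by split; [apply: adjacent_vertexl auv|apply: adjacent_vertexr auv].
Qed.

Lemma vertex_T_inj s s' w : is_vertex (T s) w -> is_vertex (T s') w -> s = s'.
Proof. by move=> /vertex_mem h /vertex_mem; exact: T_inj. Qed.

Lemma mem_qface i j v : (j < l)%N -> is_vertex P v -> qface i j v ->
  v \in [:: chain i j; chain i j.+1; (rim_ends i j).1; (rim_ends i j).2].
Proof.
move=> jl vv Qv; have [_ _ _ _ <-] := sidesP i jl.
by apply: facet_vertex => //; exact: facet_qface.
Qed.

Lemma mem_qface_T i j s w : (j < l)%N -> is_vertex (T s) w -> qface i j w ->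
  s = odd i /\ w \in [:: (rim_ends i j).1; (rim_ends i j).2].
Proof.
move=> jl vw /(mem_qface jl (vertex_T vw)).
rewrite 2!in_cons !(eq_sym w) (negPf (chain_neq_T i (ltnW jl) vw)).
rewrite (negPf (chain_neq_T i jl vw)) /= => ws; split=> //.
have [/adjacent_T[vp vq] _ _ _ _] := sidesP i jl.
by move: ws; rewrite !inE => /orP[]/eqP e; apply: vertex_T_inj vw _; rewrite e.
Qed.

Lemma mem_qface_chain i j i' j' : (j < l)%N -> (j' <= l)%N -> qface i j (chain i' j') ->
  chain i' j' = chain i j \/ chain i' j' = chain i j.+1.
Proof.
move=> jl jl' /(mem_qface jl (vertex_chain i' jl')).
have [/adjacent_T[vp vq] _ _ _ _] := sidesP i jl.
rewrite !inE (negPf (chain_neq_T i' jl' vp)) (negPf (chain_neq_T i' jl' vq)) !orbF.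
by case/orP => /eqP; [left|right].
Qed.

Lemma mem_tri G i v : is_facet P G -> G = tri i -> is_vertex P v -> G v ->
  [\/ v = a i, v = a i.+1 | v = apex i].
Proof.
move=> fG eG vv Gv; have := facet_vertex fG vv Gv.
rewrite eG => /vertex_conv_hull; rewrite a_ix a_ixS /=.
by move=> [[]|] ->; [apply: Or31|apply: Or32|apply: Or33].
Qed.

Lemma a_neq_T i s w : is_vertex (T s) w -> a i <> w.
Proof.
by move=> vw; apply/eqP; rewrite -(chain0 i); exact: (chain_neq_T i (leq0n l) vw).
Qed.

Lemma mem_tri_T G i s w : is_facet P G -> G = tri i -> is_vertex (T s) w -> G w ->
  s = ~~ odd i /\ w = apex i.
Proof.
move=> fG eG vw /(mem_tri fG eG (vertex_T vw))[e|e|e].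
- by case: (@a_neq_T i s w vw).
- by case: (@a_neq_T i.+1 s w vw).
- by split=> //; apply: (vertex_T_inj vw); rewrite e; exact: vertex_apex.
Qed.

Lemma mem_tri_chain G i i' j' : is_facet P G -> G = tri i -> (j' <= l)%N -> G (chain i' j') ->
  chain i' j' = a i \/ chain i' j' = a i.+1.
Proof.
move=> fG eG jl /(mem_tri fG eG (vertex_chain i' jl))[e|e|e]; [by left|by right|].
by have /eqP := chain_neq_T i' jl (vertex_apex i).
Qed.

(** The chains avoid the horizontal facets, and the vertices of the walls are on
    the chains. *)
Lemma facet_chain_T G i j s w : is_facet P G -> (j <= l)%N -> is_vertex (T s) w ->
  G (chain i j) -> G w ->
  (exists i' j', (j' < l)%N /\ G = qface i' j') \/ (exists i', G = tri i').
Proof.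
move=> fG jl vw GC Gw; have [s' e|i' e|i' j' jl' e|i' e] := facet_cases fG.
- by case: (@chain_notin_T s' i j jl); rewrite -e.
- have [] := @wall_cases i' w (vertex_T vw); first by rewrite -e.
  by move=> j' jl' ew; have /eqP := chain_neq_T i' jl' vw; rewrite ew.
- by left; exists i', j'.
- by right; exists i'.
Qed.

Lemma qface_mod i i' j : i = i' %[mod k.*2] -> qface i j = qface i' j.
Proof. by move/ix_eq; rewrite /qface => ->. Qed.

Lemma apex_mod i i' : i = i' %[mod k.*2] -> apex i = apex i'.
Proof. by move/ix_eq; rewrite /apex => ->. Qed.

Let dP : has_dim P 3 := Xi_dim S.

(** The edge is on two facets, and only the two quadrilaterals on the chain
    edges at the coloured vertex qualify. *)
Lemma colored_edge i j s w : (j.+1 < l)%N -> is_vertex (T s) w ->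
  adjacent P (chain i j.+1) w -> qface i j w /\ qface i j.+1 w.
Proof.
move=> jl vw aw.
have key G : is_facet P G -> G (chain i j.+1) -> G w -> G = qface i j \/ G = qface i j.+1.
  move=> fG GC Gw; have [[i' [j' [jl' e]]]|[i' e]] := facet_chain_T fG (ltnW jl) vw GC Gw.
    rewrite e in GC; have [e1|e1] := mem_qface_chain jl' (ltnW jl) GC.
      have [||ii jj] := chain_inj _ _ e1; [by []|exact: ltnW|].
      by right; rewrite e -jj; apply: qface_mod.
    have [||ii [jj]] := chain_inj _ _ e1; [by []|by []|].
    by left; rewrite e -jj; apply: qface_mod.
  have jl0 : (0 < j.+1 < l)%N by [].
  have := signed_neq0 (signed_chain i jl0).
  by have [->|->] := mem_tri_chain fG e (ltnW jl) GC; rewrite zcoord_a eqxx.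
have [G1 [G2 [f1 f2 n12 [c1 w1] [c2 w2]]]] := edge_two_facets pP dP aw.
have := key _ f1 c1 w1; have := key _ f2 c2 w2.
by move=> [e2|e2] [e1|e1]; try (by case: n12; rewrite e1 e2); rewrite -e1 -e2.
Qed.

Lemma rim_ends_succ i j : (j.+1 < l)%N -> (rim_ends i j).2 = (rim_ends i j.+1).1.
Proof.
move=> jl; have [e1 Q1 _ a1 _] := sidesP i (ltnW jl).
have [e2 Q2 a2 _ _] := sidesP i jl.
have [vp vq] := adjacent_T e1; have [vp' vq'] := adjacent_T e2.
have [_ m1] := colored_edge jl vq a1; have [m2 _] := colored_edge jl vp' a2.
have [_ {m1}] := mem_qface_T jl vq m1; rewrite !inE => /orP[/eqP//|/eqP h1].
have [_ {m2}] := mem_qface_T (ltnW jl) vp' m2; rewrite !inE => /orP[/eqP h2|/eqP//].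
(* both quadrilaterals would have the same edge on [T (odd i)] *)
have [[m n] [_ uni]] := Xi_Q_unique S e1.
have eq1 : (m, n) = (ix i, j).
  by apply: uni; split; [exact: (edge_ix i)|exact: odd_ix|exact: (ltnW jl)|exact: Q1].
have eq2 : (m, n) = (ix i, j.+1).
  have Q2' : is_edge (qface i j.+1) (segment (rim_ends i j).1 (rim_ends i j).2).
    by rewrite h1 -h2; exact: Q2.
  by apply: uni; split; [exact: (edge_ix i)|exact: odd_ix|exact: jl|exact: Q2'].
have nj : n = j := congr1 snd eq1.
have nj1 : n = j.+1 := congr1 snd eq2.
by case: (n_Sn j (etrans (esym nj) nj1)).
Qed.

Lemma eqNb (b : bool) : (~~ b == b) = false.
Proof. by case: b. Qed.

Lemma modS i i' : i.+1 = i'.+1 %[mod k.*2] -> i = i' %[mod k.*2].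
Proof. by move/eqP; rewrite -addn1 -(addn1 i') eqn_modDr => /eqP. Qed.

(** Parity decides which of the facets at a blue vertex reach [T s]: a
    quadrilateral at the end of the chain on this side, and a triangle on the
    edge of the other parity. *)
Lemma facet_aT G i s w : is_facet P G -> is_vertex (T s) w ->
  G (a i.+1) -> G w ->
  if s == odd i then G = qface i l.-1 \/ w = apex i.+1
  else G = qface i.+1 0 \/ w = apex i.
Proof.
move=> fG vw Ga Gw; have Ga' := Ga; rewrite -(chain0 i.+1) in Ga'.
have [[i' [j' [jl' e]]]|[i' e]] := facet_chain_T fG (leq0n l) vw Ga' Gw.
  have [-> _] : s = odd i' /\ w \in [:: (rim_ends i' j').1; (rim_ends i' j').2].
    by apply: mem_qface_T => //; rewrite -e.
  rewrite e in Ga'; have := mem_qface_chain jl' (leq0n l) Ga'; rewrite chain0 => -[e1|e1].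
    have [j0|j0] := chain_eq_a (ltnW jl') e1; last by rewrite j0 ltnn in jl'.
    rewrite j0 chain0 in e1; move/a_inj: e1 => e1; rewrite -(odd_mod e1) /= eqNb.
    by left; rewrite e j0; apply: qface_mod.
  have [//|j0] := chain_eq_a jl' e1.
  rewrite j0 chainl in e1; move/a_inj/modS: e1 => e1; rewrite -(odd_mod e1) eqxx.
  by left; rewrite e -j0; apply: qface_mod.
have [-> ->] := mem_tri_T fG e vw Gw.
have := mem_tri_chain fG e (leq0n l) Ga'; rewrite chain0 => -[/a_inj e1|/a_inj/modS e1].
  by rewrite -(odd_mod e1) /= negbK eqxx; right; apply: apex_mod.
rewrite -(odd_mod e1) eqNb.
by right; apply: apex_mod.
Qed.

(** Of the two facets on the edge at most one is the quadrilateral of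
    [facet_aT]; the other is a triangle, with apex [w]. *)
Lemma edge_aT i s w : is_vertex (T s) w -> adjacent P (a i.+1) w ->
  w = if s == odd i then apex i.+1 else apex i.
Proof.
move=> vw aw; have [G1 [G2 [f1 f2 n12 [c1 w1] [c2 w2]]]] := edge_two_facets pP dP aw.
have := facet_aT f1 vw c1 w1; have := facet_aT f2 vw c2 w2.
by case: ifP => _ [e2|//] [e1|//]; case: n12; rewrite e1 e2.
Qed.

(** The vertices of [T (odd i)] joined to the successive vertices of [chain i].
    The apex of the triangle on [E_(i+1)] ends this list and starts that of
    [i.+2] ([rim_end]). *)
Definition rim i j := if (j < l)%N then (rim_ends i j).1 else apex i.+1.

Lemma rim_mod i i' j : i = i' %[mod k.*2] -> rim i j = rim i' j.
Proof.
move=> e; have e' : i.+1 = i'.+1 %[mod k.*2].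
  by rewrite -addn1 -modnDml e modnDml addn1.
by rewrite /rim (rim_ends_mod _ e) (apex_mod e').
Qed.

Lemma rim0 i : rim i.+1 0 = apex i.
Proof.
have l0 : (0 < l)%N by lia.
rewrite /rim l0; have [/adjacent_T[vp _] _ + _ _] := sidesP i.+1 l0.
rewrite chain0 => /(edge_aT vp) ->.
by rewrite /= eqNb.
Qed.

Lemma riml i : rim i l = apex i.+1.
Proof. by rewrite /rim ltnn. Qed.

Lemma rim_ends2 i j : (j < l)%N -> (rim_ends i j).2 = rim i j.+1.
Proof.
move=> jl; rewrite /rim; case: ltnP => jl'; first exact: rim_ends_succ.
have [/adjacent_T[_ vq] _ _ + _] := sidesP i jl.
have -> : j.+1 = l by lia.
by rewrite chainl => /(edge_aT vq) ->; rewrite eqxx.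
Qed.

Lemma rim_ends1 i j : (j < l)%N -> (rim_ends i j).1 = rim i j.
Proof. by rewrite /rim => ->. Qed.

Lemma adjacent_rim i j : (j < l)%N -> adjacent (T (odd i)) (rim i j) (rim i j.+1).
Proof. by move=> jl; have [] := sidesP i jl; rewrite rim_ends2 // rim_ends1. Qed.

Lemma adjacent_chain_rim i j : (j <= l)%N -> adjacent P (chain i j) (rim i j).
Proof.
rewrite leq_eqVlt => /orP[/eqP->|jl]; last by have [] := sidesP i jl; rewrite rim_ends1.
have l1 : (l.-1 < l)%N by lia.
have l1S : l.-1.+1 = l by lia.
by have [_ _ _ + _] := sidesP i l1; rewrite (rim_ends2 i l1) l1S.
Qed.

Lemma vertex_rim i j : (j <= l)%N -> is_vertex (T (odd i)) (rim i j).
Proof.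
rewrite leq_eqVlt => /orP[/eqP->|jl].
  by have := vertex_apex i.+1; rewrite /= negbK riml.
by have /adjacent_T[] := adjacent_rim i jl.
Qed.

Definition quad i j := [:: chain i j; chain i j.+1; rim i j; rim i j.+1].

Lemma mem_quad i j v : (j < l)%N -> is_vertex P v -> qface i j v -> v \in quad i j.
Proof. by move=> jl vv /(mem_qface jl vv); rewrite rim_ends1 // rim_ends2. Qed.

(** An edge is an edge of one of its facets. The edges of a horizontal facet are
    shared with quadrilaterals, and the edges of a triangle at its apex are also
    edges of the adjacent quadrilaterals. *)
Lemma edge_cases u v : adjacent P u v ->
  (exists i, (u = a i /\ v = a i.+1) \/ (u = a i.+1 /\ v = a i)) \/
  (exists i j, [/\ (j < l)%N, u \in quad i j & v \in quad i j]).
Proof.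
move=> auv; have vu := adjacent_vertexl pP auv; have vv := adjacent_vertexr pP auv.
have [G [_ [fG _ _ [Gu Gv] _]]] := edge_two_facets pP dP auv.
have := facet_cases fG => -[s e|i e|i j jl e|i e].
- right; have aT : adjacent (T s) u v.
    by apply: (adjacent_sub pP) auv _ _; rewrite -?e //; exact: facet_face.
  have [[i j] [[/= ei _ jl [[n en] _]] _]] := Xi_Q_unique S aT.
  have Quv w : segment u v w -> qface i j w.
    by rewrite /qface ix_id // en => -[].
  exists i, j; split=> //; apply: mem_quad => //; apply: Quv.
    exact: segmentl.
  exact: segmentr.
- have aF : adjacent (wall i) u v.
    by apply: (adjacent_sub pP) auv _ _; rewrite -?e //; exact: facet_face.
  have [eq|[j jl eq]] := proj1 (Xi_F_edges S (edge_ix i) _) aF.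
    rewrite a_ix a_ixS in eq.
    by left; exists i; have [[-> ->]|[-> ->]] := segment_inj eq; [left|right].
  right; exists i, j; rewrite /quad /chain !inE; split=> //.
    by have [[-> _]|[-> _]] := segment_inj eq; rewrite eqxx ?orbT.
  by have [[_ ->]|[_ ->]] := segment_inj eq; rewrite eqxx ?orbT.
- by right; exists i, j; split=> //; apply: mem_quad => //; rewrite -e.
- have l0 : (0 < l)%N by lia.
  have l1 : (l.-1 < l)%N by lia.
  have inl : exists i', (a i \in quad i' l.-1) && (apex i \in quad i' l.-1).
    exists (ix i).-1; rewrite /quad prednK // chainl riml !inE /ix /=.
    by rewrite -/(ix i) a_ix eqxx /apex ix_ix eqxx !orbT.
  have inr : (a i.+1 \in quad i.+1 0) && (apex i \in quad i.+1 0).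
    by rewrite /quad chain0 rim0 !inE !eqxx !orbT.
  have [i' /andP[l2' l3]] := inl; have /andP[r2 r3] := inr.
  have uv := adjacent_neq auv.
  have := mem_tri fG e vu Gu; have := mem_tri fG e vv Gv.
  case=> ev; case=> eu; rewrite ?ev ?eu in uv *; rewrite ?eqxx // in uv.
  + by left; exists i; right.
  + by right; exists i', l.-1; split.
  + by left; exists i; left.
  + by right; exists i.+1, 0%N; split.
  + by right; exists i', l.-1; split.
  + by right; exists i.+1, 0%N; split.
Qed.

Lemma rim_end i : rim i l = rim i.+2 0.
Proof. by rewrite riml rim0. Qed.

(** Every vertex is on an edge, and among the edges only those inside
    quadrilaterals reach the horizontal facets. *)
Lemma rim_onto s v : is_vertex (T s) v ->
  exists i j, [/\ odd i = s, (j < l)%N & v = rim i j].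
Proof.
move=> vv; have vP := vertex_T vv.
have [|w aw] := vertex_in_edge pP vP (vertex_a 0).
  by apply/eqP; exact: (@a_neq_T 0 s v vv).
have [[i [[e _]|[e _]]]|[i [j [jl + _]]]] := edge_cases aw.
- by case: (@a_neq_T i s v vv).
- by case: (@a_neq_T i.+1 s v vv).
rewrite 2!in_cons !(eq_sym v) (negPf (chain_neq_T i (ltnW jl) vv)).
rewrite (negPf (chain_neq_T i jl vv)) /= => h.
have [j' jl' e] : exists2 j', (j' <= l)%N & v = rim i j'.
  move: h; rewrite !inE => /orP[]/eqP e.
    by exists j => //; exact: ltnW.
  by exists j.+1.
have si : odd i = s by apply: (@vertex_T_inj _ _ v) vv; rewrite e; exact: vertex_rim.
move: jl'; rewrite leq_eqVlt => /orP[/eqP jl'|jl'].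
  by exists i.+2, 0%N; rewrite -rim_end e jl' /= negbK; split=> //; lia.
by exists i, j'.
Qed.

(** The vertices of the horizontal facet on the side [s], numbered from 0 to [k * l - 1]
    along the chains with this parity. *)
Definition cyclic_rim s m := rim ((m %/ l).*2 + s) (m %% l).

Lemma rim_cyclic i j : (j <= l)%N -> rim i j = cyclic_rim (odd i) ((i./2 * l + j) %% (k * l)).
Proof.
suff h i' j' : (j' < l)%N -> rim i' j' = cyclic_rim (odd i') ((i'./2 * l + j') %% (k * l)).
  rewrite leq_eqVlt => /orP[/eqP->|/h//].
  rewrite rim_end h /=; last by lia.
  by rewrite negbK addn0 mulSn addnC.
move=> jl; rewrite /cyclic_rim.
have l0 : (0 < l)%N by lia.
have k0 : (0 < k)%N by lia.
have -> : ((i'./2 * l + j') %% (k * l) = (i'./2 %% k) * l + j')%N.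
  rewrite {1}(divn_eq i'./2 k) mulnDl -mulnA -addnA modnMDl modn_small //.
  have : (i'./2 %% k < k)%N by rewrite ltn_mod.
  by move: (i'./2 %% k)%N => m mk; nia.
rewrite divnMDl // modnMDl (divn_small jl) addn0 (modn_small jl).
by apply: rim_mod; rewrite -[in LHS](odd_double_half i') -!muln2 muln_modl modnDml addnC.
Qed.

(** The facet has [k * l] vertices, and the [k * l] values of [cyclic_rim]
    exhaust them. *)
Lemma rim_inj i i' j j' : odd i = odd i' -> (j <= l)%N -> (j' <= l)%N ->
  rim i j = rim i' j' -> i./2 * l + j = i'./2 * l + j' %[mod k * l].
Proof.
move=> si jl jl'; rewrite (rim_cyclic i jl) (rim_cyclic i' jl') si => e.
have kl0 : (0 < k * l)%N by rewrite muln_gt0; lia.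
apply: (surjective_card_inj (Xi_T_card S (odd i')) _ _ _ e); rewrite ?ltn_mod //.
move=> v vv; have [i1 [j1 [s1 jl1 ->]]] := rim_onto vv.
exists ((i1./2 * l + j1) %% (k * l))%N; first by rewrite ltn_mod.
by rewrite -s1 -rim_cyclic // ltnW.
Qed.

(** * Faces exposed by horizontal and by tilted forms *)

Lemma mod_neq i m : (0 < m < k.*2)%N -> i <> i + m %[mod k.*2].
Proof.
move=> hm /eqP; rewrite eq_sym -[X in _ == X %[mod _]]addn0 eqn_modDl.
by rewrite !modn_small; lia.
Qed.

Lemma chain_eq_cases i i' j j' : (j <= l)%N -> (j' <= l)%N -> chain i j = chain i' j' ->
  [\/ i = i' %[mod k.*2] /\ j = j',
      [/\ j = 0%N, j' = l & i = i'.+1 %[mod k.*2]] |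
      [/\ j = l, j' = 0%N & i.+1 = i' %[mod k.*2]]].
Proof.
move=> jl jl' e.
have [h|h] := boolP (0 < j < l)%N; first by have := chain_inj h jl' e; apply: Or31.
have [h'|h'] := boolP (0 < j' < l)%N.
  by have [-> ->] := chain_inj h' jl (esym e); apply: Or31.
have [j0|j0] : j = 0%N \/ j = l by lia.
  rewrite j0 chain0 in e; have [j0'|j0'] : j' = 0%N \/ j' = l by lia.
    by apply: Or31; rewrite j0' chain0 in e; move/a_inj: e; rewrite j0 j0'.
  by apply: Or32; rewrite j0' chainl in e; move/a_inj: e.
rewrite j0 chainl in e; have [j0'|j0'] : j' = 0%N \/ j' = l by lia.
  by apply: Or33; rewrite j0' chain0 in e; move/a_inj: e.
by apply: Or31; rewrite j0' chainl in e; move/a_inj/modS: e; rewrite j0 j0'.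
Qed.

Lemma ix_pred i : exists m, [/\ a i = a m.+1, a i.+1 = a m.+2 & i = m.+1 %[mod k.*2]].
Proof.
exists (ix i).-1; have -> : (ix i).-1.+1 = ix i by rewrite /ix.
by rewrite a_ix a_ixS ix_modl.
Qed.

(** Two consecutive walls meet only at their common blue vertex, where the sum
    of the horizontal forms exposing them is maximal. *)
Lemma a_exposed i : exists n, zcoord n = 0 /\ face P n = [set a i].
Proof.
have [m [-> _ _]] := ix_pred i.
have [n1 [z1 e1]] := wall_horizontal m.
have [n2 [z2 e2]] := wall_horizontal m.+1.
have f1 : face P n1 (a m.+1) by rewrite -e1 -chainl; exact: chain_in_wall.
have f2 : face P n2 (a m.+1) by rewrite -e2 -chain0; exact: chain_in_wall.
exists (n1 + n2); split; first by move: z1 z2; rewrite /zcoord mxE => -> ->; rewrite addr0.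
have fI := faceI f1 f2.
have fa : face P (n1 + n2) (a m.+1) by rewrite fI.
rewrite (face_segment pP fa fa); first by rewrite segment_hull setUid conv_hull1.
move=> v vv; rewrite fI -e1 -e2 => -[/(wall_cases vv)[j jl ev] /(wall_cases vv)[j' jl' ev']].
left; have [] := chain_eq_cases jl jl' (etrans (esym ev) ev').
- by move=> [/esym h _]; case: (@mod_neq m 1); [lia|rewrite addn1].
- by move=> [_ _ h]; case: (@mod_neq m 2); [lia|rewrite addn2].
- by move=> [j0 _ _]; rewrite ev j0 chainl.
Qed.

(** A large multiple of a horizontal form exposing [a i], plus or minus the
    height. *)
Lemma a_exposed_signed i s : exists f, signed s (zcoord f) /\ face P f = [set a i].
Proof.
have [n [n0 e]] := a_exposed i.
have fa : face P n (a i) by rewrite e.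
pose d : pt := mkpt 0 0 (if s then 1 else -1).
have fd : face (face P n) d (a i) by rewrite e; split=> // y ->.
have [M _ eM] := face_of_face pP fd.
exists (M *: n + d); split.
  move: n0; rewrite /zcoord !mxE => ->; rewrite mulr0 add0r.
  by case: (s) => /=; rewrite ?ltr01 ?ltrN10.
rewrite eM e; apply/seteqP; split=> [x []//|x ->].
by move: fd; rewrite e.
Qed.

(** The polytope contains its projection: moving a point below the plane of the
    polygon up to this plane increases a form that increases upwards. *)
Lemma face_signed s f v : signed s (zcoord f) -> face P f v ->
  ~ signed (~~ s) (zcoord v).
Proof.
move=> sf fv; have := fv.2 _ (proj_in fv.1); rewrite [X in _ <= X]dotv_proj lerDl.
by case: (s) sf => /= h1 h2 h3; nra.
Qed.

(** A horizontal form does not distinguish [v] from its projection, which is a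
    combination of blue vertices. *)
Lemma face_horizontal f v : zcoord f = 0 -> face P f v ->
  conv_hull [set u | (exists m, u = a m) /\ face P f u] (proj v).
Proof.
move=> f0 fv.
have ea : dotv f (proj v) = dotv f v by rewrite [RHS]dotv_proj f0 mul0r addr0.
have le u : [set a m | m in [set m | edge_index k m]] u -> dotv f u <= dotv f v.
  by move=> [m _ <-]; apply: fv.2; exact: vertex_mem (vertex_a m).
apply: (conv_hull_mono _ (conv_hull_level le (proj_hull fv.1) ea)) => u [[m _ <-] e].
apply: sub_conv_hull; split; first by exists m.
by apply/(face_eqval fv) => //; exact: vertex_mem (vertex_a m).
Qed.

Lemma signed_contra s (x : R) : x <> 0 -> ~ signed (~~ s) x -> signed s x.
Proof. by case: s => /= /eqP x0 /negP; rewrite -leNgt le_eqVlt ?(eq_sym 0) (negPf x0). Qed.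

Lemma mem_segment_vertex u v w : is_vertex P w -> is_face P (segment u v) ->
  segment u v w -> w = u \/ w = v.
Proof.
move=> vw [f e] sw; apply/segment_vertexP.
by apply: (vertex_subset _ vw sw); rewrite e; exact: face_sub.
Qed.

(** A horizontal form maximal at a coloured vertex would be maximal at both ends
    of [E_i], and an edge has only two vertices; a form of the other sign is
    excluded by [face_signed]. *)
Lemma chain_signed i j f : (j < l)%N -> face P f = segment (chain i j) (chain i j.+1) ->
  signed (odd i) (zcoord f).
Proof.
move=> jl e; have fe : is_face P (segment (chain i j) (chain i j.+1)) by exists f.
have [j1 hj1 fp] : exists2 j1, (0 < j1 < l)%N & face P f (chain i j1).
  have [j0|j0] := posnP j.
    by exists j.+1; [lia|rewrite e; exact: segmentr].
  by exists j; [rewrite j0|rewrite e; exact: segmentl].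
have sp := signed_chain i hj1.
apply: signed_contra => [f0|sf]; last by apply: (face_signed sf fp); rewrite negbK.
have [fa fb] := face_open_edge f0 fp (open_chain i hj1).
have aC m m' j2 : (0 < j2 < l)%N -> a m <> chain m' j2.
  by move=> h e'; have := signed_neq0 (signed_chain m' h); rewrite -e' zcoord_a eqxx.
rewrite e in fa fb; have ab := aS_neq i.
have := mem_segment_vertex (vertex_a i) fe fa.
have := mem_segment_vertex (vertex_a i.+1) fe fb.
have [j0|j0] := posnP j.
  have h : (0 < j.+1 < l)%N by lia.
  by move=> [e1|/(aC _ _ _ h)//] [e2|/(aC _ _ _ h)//]; rewrite e1 e2 eqxx in ab.
have h : (0 < j < l)%N by lia.
by move=> [/(aC _ _ _ h)//|e1] [/(aC _ _ _ h)//|e2]; rewrite e1 e2 eqxx in ab.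
Qed.

(** A horizontal form would be maximal at the projection of [rim i j], which
    would then be the blue end of the edge, contrary to [above_a]. *)
Lemma spoke_signed i j f : (j <= l)%N -> face P f = segment (chain i j) (rim i j) ->
  signed (odd i) (zcoord f).
Proof.
move=> jl e; have fe : is_face P (segment (chain i j) (rim i j)) by exists f.
have vw := vertex_rim i jl; have sp := signed_T (vertex_mem vw).
have fp : face P f (rim i j) by rewrite e; exact: segmentr.
apply: signed_contra => [f0|sf]; last by apply: (face_signed sf fp); rewrite negbK.
have := face_horizontal f0 fp; set A := [set u | _].
have AC u : A u -> u = chain i j.
  move=> [[m ->] fa]; rewrite e in fa.
  by have [//|e1] := mem_segment_vertex (vertex_a m) fe fa; case: (a_neq_T vw e1).
move=> hA; have [u Au] : exists u, A u.
  apply: contrapT => no; move: hA; have -> : A = set0.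
    by apply/seteqP; split=> // u Au; apply: no; exists u.
  by rewrite conv_hull0.
have [[m eu] _] := Au.
have pW : proj (rim i j) = chain i j.
  have : conv_hull [set chain i j] (proj (rim i j)).
    by apply: conv_hull_mono hA => u' /AC ->; exact: sub_conv_hull.
  by rewrite conv_hull1.
have Ca : chain i j = a m by rewrite -(AC u Au).
have := above_a (vertex_T vw) (etrans pW Ca).
by move=> /esym /(a_neq_T vw).
Qed.

(** The coloured vertices of [E_i] project into [E_i], so that the form must
    decrease on the way to them. *)
Lemma a_signed i f : face P f = segment (a i) (a i.+1) ->
  signed (~~ odd i) (zcoord f).
Proof.
move=> e; have fe : is_face P (segment (a i) (a i.+1)) by exists f.
have l1 : (0 < 1 < l)%N by lia.
have sC := signed_chain i l1; have vC : is_vertex P (chain i 1) by apply: vertex_chain; lia.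
have fp : face P f (proj (chain i 1)).
  have [r /andP[r0 r1] er] := open_chain i l1; rewrite e; exists r => //=.
  by rewrite !ltW.
have le := fp.2 _ (vertex_mem vC); rewrite dotv_proj gerDl in le.
apply: signed_contra => [f0|]; last first.
  rewrite negbK; case: (odd i) sC => /= h1 h2; move: le; rewrite leNgt.
    by rewrite mulr_gt0.
  by rewrite nmulr_rgt0 ?h1.
have : face P f (chain i 1).
  by apply/(face_eqval fp); rewrite ?[LHS]dotv_proj ?f0 ?mul0r ?addr0 //; exact: vertex_mem.
rewrite e => /(mem_segment_vertex vC fe) h.
by have := signed_neq0 sC; case: h => ->; rewrite zcoord_a eqxx.
Qed.

(** * The diameter of Xi *)

(** One of the two ways around takes at most [k] moves. *)
Lemma within_cycle (X : set pt) (b : nat -> pt) e :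
  (forall i i', i = i' %[mod k.*2] -> b i = b i') ->
  (forall i, within X (b i) (b i.+1) e) ->
  forall i i', within X (b i) (b i') (e * k).
Proof.
move=> bmod hb.
have step i m : within X (b i) (b (i + m)%N) (e * m).
  elim: m => [|m IH]; first by rewrite addn0; exact: within_refl.
  by rewrite addnS mulnSr; apply: within_trans IH (hb _).
have key i i' : (i <= i')%N -> (i' < k.*2)%N -> within X (b i) (b i') (e * k).
  move=> ii ik; have [le|gt] := leqP (i' - i) k.
    rewrite -{1}(subnKC ii); apply: within_leq (step _ _) _.
    by rewrite leq_mul2l le orbT.
  apply: within_sym.
  rewrite (bmod i (i' + (i + k.*2 - i')))%N; last first.
    by rewrite subnKC ?modnDr //; lia.
  apply: within_leq (step _ _) _; rewrite leq_mul2l; apply/orP; right; lia.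
move=> i i'; rewrite -(bmod (i %% k.*2)%N i) -?(bmod (i' %% k.*2)%N i') ?modn_mod //.
have : (i %% k.*2 < k.*2)%N by rewrite ltn_mod; lia.
have : (i' %% k.*2 < k.*2)%N by rewrite ltn_mod; lia.
move: (i %% k.*2)%N (i' %% k.*2)%N => {}i {}i' ik' ik.
by have [ii|/ltnW ii] := leqP i i'; [exact: key|apply/within_sym/key].
Qed.

Lemma within_chain (X : set pt) (y : pt) i j :
  (forall j', (j' < l)%N -> adjacent X (chain i j' + y) (chain i j'.+1 + y)) ->
  (j <= l)%N -> within X (chain i j + y) (a i + y) j.
Proof.
move=> h; elim: j => [_|j IH jl]; first by rewrite chain0; exact: within_refl.
apply: (@within_leq _ _ _ _ _ (1 + j)) => //; apply: within_trans (IH (ltnW jl)).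
by apply/within_sym/within_adjacent/h.
Qed.

(** A chain leads from a coloured vertex to a blue one, and from a horizontal
    facet one step leads to a chain. *)
Lemma near_a v : is_vertex P v -> exists i, within P v (a i) l.+1.
Proof.
have down i j : (j <= l)%N -> within P (chain i j) (a i) j.
  move=> jl; rewrite -[chain i j]addr0 -[a i]addr0; apply: within_chain => // j' jl'.
  by rewrite !addr0; exact: adjacent_chain.
move=> /vertex_cases[i j jl ->|s vs].
  by exists i; apply: within_leq (down _ _ (ltnW jl)) _; lia.
have [i [j [_ jl ->]]] := rim_onto vs; exists i.
apply: (@within_leq _ _ _ _ _ (1 + j)); last by lia.
apply: within_trans (down _ _ (ltnW jl)).
by apply/within_sym/within_adjacent/adjacent_chain_rim/ltnW.
Qed.

Lemma within_Xi u v : is_vertex P u -> is_vertex P v ->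
  within P u v (k + (l.+1).*2).
Proof.
move=> /near_a[i hu] /near_a[i' hv].
apply: (@within_leq _ _ _ _ _ (l.+1 + (1 * k + l.+1))); last by lia.
apply: (within_trans hu); apply: (within_trans _ (within_sym hv)).
apply: within_cycle => [m m' /a_inj//|m].
exact/within_adjacent/adjacent_a.
Qed.

Context (l4 : l = 4%N).

Local Notation N := (2 * k.*2)%N.

Lemma eqmod_double i i' x : i = i' %[mod k.*2] ->
  (2 * i + x = 2 * i' + x %[mod N])%N.
Proof. by move=> e; rewrite -modnDml -muln_modr e muln_modr modnDml. Qed.

Lemma rim_position i i' j j' : odd i = odd i' -> (j <= l)%N -> (j' <= l)%N ->
  rim i j = rim i' j' -> (2 * i + j = 2 * i' + j' %[mod N])%N.
Proof.
move=> oi jl jl' /(rim_inj oi jl jl') e.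
have eN : (k * l = N)%N by rewrite l4; lia.
have pos m m' : (2 * m + m' = (m./2 * l + m') + 2 * odd m)%N.
  by rewrite l4 -[in LHS](odd_double_half m); lia.
by rewrite !pos oi -[LHS]modnDml -eN e modnDml.
Qed.

(** The place of a vertex on a cycle of length [4 * k], through its distance to
    0. Each edge of the polygon has length 2, and each edge of a horizontal
    facet has length 1 for [l = 4]; truncating at 2 fits the chain of 4 edges
    above an edge of the polygon. *)
Definition position v d := exists i j x, [/\ (j <= l)%N,
  (v = chain i j /\ x = 2 * i + minn j 2)%N \/ (v = rim i j /\ x = 2 * i + j)%N &
  d = cyclic_norm N x].

Lemma cyclic_norm_mod x y : x = y %[mod N] -> cyclic_norm N x = cyclic_norm N y.
Proof. by rewrite /cyclic_norm => ->. Qed.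

Lemma position_fun v d d' : position v d -> position v d' -> d = d'.
Proof.
move=> [i [j [x [jl hx ->]]]] [i' [j' [x' [jl' hx' ->]]]]; apply: cyclic_norm_mod.
case: hx hx' => -[-> ->] [] [e ->].
- case: (chain_eq_cases jl jl' e) => [[ii ->]|[j0 j0' ii]|[j0 j0' ii]].
  + exact: eqmod_double.
  + by rewrite (eqmod_double _ ii) j0 j0' l4; congr (_ %% _)%N; lia.
  + by rewrite -(eqmod_double _ ii) j0 j0' l4; congr (_ %% _)%N; lia.
- by have /eqP := chain_neq_T i jl (vertex_rim i' jl').
- by have /eqP := chain_neq_T i' jl' (vertex_rim i jl); rewrite e.
- apply: rim_position => //; apply: (vertex_T_inj (vertex_rim i jl)).
  by rewrite e; exact: vertex_rim.
Qed.

Lemma position_chain i j : (j <= l)%N -> position (chain i j) (cyclic_norm N (2 * i + minn j 2)).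
Proof. by move=> jl; exists i, j, (2 * i + minn j 2)%N; split=> //; left. Qed.

Lemma position_rim i j : (j <= l)%N -> position (rim i j) (cyclic_norm N (2 * i + j)).
Proof. by move=> jl; exists i, j, (2 * i + j)%N; split=> //; right. Qed.

Lemma position_quad i j v : (j < l)%N -> v \in quad i j ->
  exists x, position v (cyclic_norm N x) /\
    (2 * i + minn j 2 <= x <= 2 * i + minn j 2 + 2)%N.
Proof.
move=> jl; rewrite !inE => /or4P[] /eqP ->.
- by eexists; split; [exact: (position_chain i (ltnW jl))|lia].
- by eexists; split; [exact: (position_chain i jl)|lia].
- by eexists; split; [exact: (position_rim i (ltnW jl))|lia].
- by eexists; split; [exact: (position_rim i jl)|lia].
Qed.

Lemma position_lipschitz w w' : adjacent P w w' ->
  exists d d', [/\ position w d, position w' d' & (d' <= d + 2)%N].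
Proof.
have blue i : position (a i) (cyclic_norm N (2 * i)).
  by have := position_chain i (leq0n l); rewrite chain0 addn0.
move=> /edge_cases[[i [[-> ->]|[-> ->]]]|[i [j [jl hw hw']]]].
- do 2 eexists; split; [exact: blue|exact: blue|].
  by apply: cyclic_norm_lipschitz; lia.
- do 2 eexists; split; [exact: blue|exact: blue|].
  by apply: cyclic_norm_lipschitz; lia.
have [x [px hx]] := position_quad jl hw; have [x' [px' hx']] := position_quad jl hw'.
do 2 eexists; split; [exact: px|exact: px'|].
by apply: cyclic_norm_lipschitz; lia.
Qed.

Lemma cyclic_norm_antipode : cyclic_norm N (2 * k) = (2 * k)%N.
Proof. by rewrite /cyclic_norm modn_small; lia. Qed.

Lemma cyclic_norm0 : cyclic_norm N 0 = 0%N.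
Proof. by rewrite /cyclic_norm mod0n min0n. Qed.

Lemma walk_Xi m : walk P (a 0) (a k) m -> (k <= m)%N.
Proof.
move=> w.
have h0 : position (a 0) 0.
  by have := position_chain 0 (leq0n l); rewrite chain0 muln0 min0n cyclic_norm0.
have hk : position (a k) (2 * k).
  by have := position_chain k (leq0n l); rewrite chain0 addn0 cyclic_norm_antipode.
by have := walk_variation position_fun position_lipschitz w h0 hk; lia.
Qed.

Lemma diameter_Xi : (k%:R <= diameter P <= (k + 10)%:R).
Proof.
have W10 u v : is_vertex P u -> is_vertex P v -> within P u v (k + 10).
  by move=> vu vv; have := within_Xi vu vv; rewrite l4.
apply/andP; split; last exact: (diameter_le W10 (vertex_a 0)).
exact: (diameter_ge W10 (vertex_a 0) (vertex_a k) walk_Xi).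
Qed.

(** * The diameter of the sum *)

Context {lo hi : pt} (xlh : xcoord lo = xcoord hi) (ylh : ycoord lo = ycoord hi)
  (zlh : zcoord lo < zcoord hi).
Local Notation X := (minkowski_sum P (segment lo hi)).
Local Notation endp := (@endpoint R lo hi).

Lemma adjacent_signed s u v : adjacent P u v ->
  (forall f, face P f = segment u v -> signed s (zcoord f)) ->
  adjacent X (u + endp s) (v + endp s).
Proof.
move=> /adjacentP[uv [f e]] h.
exact: (adjacent_sum xlh ylh zlh (h f (esym e)) uv (esym e)).
Qed.

Lemma adjacent_sum_chain i j : (j < l)%N ->
  adjacent X (chain i j + endp (odd i)) (chain i j.+1 + endp (odd i)).
Proof.
move=> jl; apply: adjacent_signed; first exact: adjacent_chain.
by move=> f; exact: chain_signed.
Qed.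

Lemma adjacent_sum_spoke i j : (j <= l)%N ->
  adjacent X (chain i j + endp (odd i)) (rim i j + endp (odd i)).
Proof.
move=> jl; apply: adjacent_signed; first exact: adjacent_chain_rim.
by move=> f; exact: spoke_signed.
Qed.

Lemma adjacent_sum_a i : adjacent X (a i + endp (~~ odd i)) (a i.+1 + endp (~~ odd i)).
Proof. by apply: adjacent_signed; [exact: adjacent_a|exact: a_signed]. Qed.

Lemma within_sum_vertical i s s' : within X (a i + endp s) (a i + endp s') 1.
Proof.
have [n [n0 e]] := a_exposed i.
have av := within_adjacent (adjacent_sum_vertical xlh ylh zlh n0 e).
have refl y : within X y y 1 by apply: within_leq (within_refl _ _ 0) _.
by case: s s' => -[] //; exact: within_sym.
Qed.

Lemma near_a_sum x : is_vertex X x -> exists i s, within X x (a i + endp s) l.+1.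
Proof.
move=> /(vertex_sum_cases xlh ylh zlh)[s [v [f [-> sf e]]]].
have fv : face P f v by rewrite e.
have vv : is_vertex P v by exists f.
have down i j : (j <= l)%N -> within X (chain i j + endp (odd i)) (a i + endp (odd i)) j.
  by move=> jl; apply: within_chain => // j'; exact: adjacent_sum_chain.
have sv s' : signed s' (zcoord v) -> s = s'.
  move=> s'v; have := face_signed sf fv.
  by case: (s) (s') s'v => -[] // s'v /(_ s'v).
case/vertex_cases: vv => [i j jl ev|s' vs]; last first.
  have [i [j [si jl ev]]] := rim_onto vs.
  have -> : s = odd i by rewrite si; exact: (sv _ (signed_T (vertex_mem vs))).
  rewrite ev; exists i, (odd i); apply: (@within_leq _ _ _ _ _ (1 + j)); last by lia.
  apply: within_trans (down _ _ (ltnW jl)).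
  by apply/within_sym/within_adjacent/adjacent_sum_spoke/ltnW.
have [j0|j0] := posnP j.
  exists i, s; rewrite ev j0 chain0; apply: within_leq (within_refl _ _ 0) _; lia.
have h : (0 < j < l)%N by rewrite j0.
have -> : s = odd i by apply: sv; rewrite ev; exact: signed_chain.
by rewrite ev; exists i, (odd i); apply: within_leq (down _ _ (ltnW jl)) _; lia.
Qed.

(** Two steps advance by one edge of the polygon: along this edge, which is an
    edge of the sum at the top or at the bottom according to its parity, and
    along the vertical edge at its end. *)
Lemma within_sum u v : is_vertex X u -> is_vertex X v ->
  within X u v (k.*2 + (l.+2).*2).
Proof.
pose b i := a i + endp (~~ odd i).
have near_b x : is_vertex X x -> exists i, within X x (b i) l.+2.
  move=> /near_a_sum[i [s h]]; exists i.
  apply: (@within_leq _ _ _ _ _ (l.+1 + 1)); last by rewrite addn1.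
  exact: within_trans h (within_sum_vertical _ _ _).
move=> /near_b[i hu] /near_b[i' hv].
apply: (@within_leq _ _ _ _ _ (l.+2 + (2 * k + l.+2))); last by lia.
apply: (within_trans hu); apply: (within_trans _ (within_sym hv)).
apply: within_cycle => [m m' e|m].
  by rewrite /b (proj2 (a_inj _ _) e) (odd_mod e).
apply: (@within_trans _ _ _ _ (a m.+1 + endp (~~ odd m)) _ 1 1).
  exact/within_adjacent/adjacent_sum_a.
exact: within_sum_vertical.
Qed.

(** In the sum, the polygon edges and the vertical edges of the zigzag have
    length 1. The ends of the chain of [i] are three edges of the zigzag apart
    (vertical, horizontal, vertical), whence the truncation at 3. *)
Definition sum_position v d := exists i j x, [/\ (j <= l)%N,
  (v = chain i j + endp (odd i) /\ x = (2 * i + minn j 3)%N) \/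
  (v = rim i j + endp (odd i) /\ x = (2 * i + j)%N) & d = cyclic_norm N x].

Lemma zcoordD u v : zcoord (u + v) = zcoord u + zcoord v.
Proof. by rewrite /zcoord mxE. Qed.

(** A top copy of a point above the plane of the polygon is higher than a bottom
    copy of a point below it. *)
Lemma endpoint_inj s s' u u' : ~ signed (~~ s) (zcoord u) -> ~ signed (~~ s') (zcoord u') ->
  u + endp s = u' + endp s' -> s = s' /\ u = u'.
Proof.
move=> su su' e; have ez := congr1 (@zcoord R) e; rewrite !zcoordD in ez.
suff ss : s = s' by split=> //; move: e; rewrite ss => /addIr.
move: ez su su' {e}; rewrite /endpoint; have := zlh.
by case: (s) (s') => -[] //= h ez /negP + /negP; rewrite -!leNgt => h1 h2; lra.
Qed.

Lemma chain_side i j : (j <= l)%N -> ~ signed (~~ odd i) (zcoord (chain i j)).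
Proof.
move=> jl; have [->|j0] := posnP j; first by rewrite chain0 zcoord_a; case: odd; rewrite /= ltxx.
have [->|jl'] := eqVneq j l; first by rewrite chainl zcoord_a; case: odd; rewrite /= ltxx.
have h : (0 < j < l)%N by lia.
by move=> /(signed_inj (signed_chain i h)); case: odd.
Qed.

Lemma rim_side i j : (j <= l)%N -> ~ signed (~~ odd i) (zcoord (rim i j)).
Proof.
move=> jl; move=> /(signed_inj (signed_T (vertex_mem (vertex_rim i jl)))).
by case: odd.
Qed.

Lemma sum_position_fun v d d' : sum_position v d -> sum_position v d' -> d = d'.
Proof.
move=> [i [j [x [jl hx ->]]]] [i' [j' [x' [jl' hx' ->]]]]; apply: cyclic_norm_mod.
have sC := @chain_side i j jl; have sW := @rim_side i j jl.
have sC' := @chain_side i' j' jl'; have sW' := @rim_side i' j' jl'.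
case: hx hx' => -[-> ->] [] [e ->].
- have [oi /(chain_eq_cases jl jl')] := endpoint_inj sC sC' e.
  move=> [[ii ->]|[_ _ ii]|[_ _ ii]].
  + exact: eqmod_double.
  + by have := odd_mod ii; rewrite oi /=; case: odd.
  + by have := odd_mod ii; rewrite -oi /=; case: odd.
- have [_ e'] := endpoint_inj sC sW' e.
  by have /eqP := chain_neq_T i jl (vertex_rim i' jl').
- have [_ e'] := endpoint_inj sW sC' e.
  by have /eqP := chain_neq_T i' jl' (vertex_rim i jl); rewrite e'.
- by have [oi] := endpoint_inj sW sW' e; exact: rim_position.
Qed.

Lemma sum_position_chain i j : (j <= l)%N ->
  sum_position (chain i j + endp (odd i)) (cyclic_norm N (2 * i + minn j 3)).
Proof. by move=> jl; exists i, j, (2 * i + minn j 3)%N; split=> //; left. Qed.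

Lemma sum_position_rim i j : (j <= l)%N ->
  sum_position (rim i j + endp (odd i)) (cyclic_norm N (2 * i + j)).
Proof. by move=> jl; exists i, j, (2 * i + j)%N; split=> //; right. Qed.

Lemma sum_position_a i : sum_position (a i + endp (odd i)) (cyclic_norm N (2 * i)).
Proof. by have := sum_position_chain i (leq0n l); rewrite chain0 addn0. Qed.

(** The end of the chain of [i]; [chain i.+1] does not describe it, being on the
    other side. *)
Lemma sum_position_aS i : sum_position (a i.+1 + endp (odd i)) (cyclic_norm N (2 * i + 3)).
Proof. by have := sum_position_chain i (leqnn l); rewrite chainl l4. Qed.

Lemma sum_position_quad i j v : (j < l)%N -> v \in quad i j ->
  exists x, sum_position (v + endp (odd i)) (cyclic_norm N x) /\
    (2 * i + minn j 3 <= x <= 2 * i + minn j 3 + 1)%N.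
Proof.
move=> jl; rewrite !inE => /or4P[] /eqP ->.
- by eexists; split; [exact: (sum_position_chain i (ltnW jl))|lia].
- by eexists; split; [exact: (sum_position_chain i jl)|lia].
- by eexists; split; [exact: (sum_position_rim i (ltnW jl))|lia].
- by eexists; split; [exact: (sum_position_rim i jl)|lia].
Qed.

(** At most one of the four vertices is in the plane of the polygon, as a chain
    has more than one edge. *)
Lemma quad_signed i j u v : (j < l)%N -> u \in quad i j -> v \in quad i j ->
  u != v -> signed (odd i) (zcoord u) \/ signed (odd i) (zcoord v).
Proof.
move=> jl hu hv uv.
have key w : w \in quad i j -> signed (odd i) (zcoord w) \/
    (w = chain i 0 /\ j = 0%N) \/ (w = chain i l /\ j.+1 = l).
  rewrite !inE => /or4P[] /eqP ->.
  - have [->|j0] := posnP j; [by right; left|left].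
    by apply: signed_chain; rewrite j0.
  - have [jl'|jl'] := eqVneq j.+1 l; first by rewrite jl'; right; right.
    by left; apply: signed_chain; lia.
  - by left; apply: signed_T (vertex_mem (vertex_rim i (ltnW jl))).
  - by left; apply: signed_T (vertex_mem (vertex_rim i jl)).
have [|[[eu ju]|[eu ju]]] := key u hu; [by left| |];
  have [|[[ev jv]|[ev jv]]] := key v hv; try (by right); try lia.
- by rewrite eu ev eqxx in uv.
- by rewrite eu ev eqxx in uv.
Qed.

(** The face contains a translate of the vertical segment, so that all of it is
    vertical, and it is above some blue vertex; [above_a] excludes other
    vertices there. *)
Lemma face_vertical f x y : zcoord f = 0 ->
  segment x y = minkowski_sum (face P f) (segment lo hi) ->
  exists i, segment x y = segment (a i + lo) (a i + hi).
Proof.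
move=> f0 e.
have [v0 fv0] : exists v, face P f v.
  by have [v fv _] : minkowski_sum (face P f) (segment lo hi) x;
    [rewrite -e; exact: segmentl|exists v].
have [i fa] : exists i, face P f (a i).
  apply: contrapT => no; have := face_horizontal f0 fv0.
  set A := [set u | _]; have -> : A = set0.
    by apply/seteqP; split=> // u [[m ->] fm]; apply: no; exists m.
  by rewrite conv_hull0.
have dir u v : segment x y u -> segment x y v -> exists r : R, v - u = r *: (y - x).
  move=> [r _ <-] [r' _ <-]; exists (r' - r).
  by apply/rowP => m; rewrite !mxE; ring.
have sxy v w : face P f v -> segment lo hi w -> segment x y (v + w).
  by move=> fv sw; rewrite e; exists v => //; exists w.
exists i.
suff eF : face P f = [set a i].
  rewrite e eF addrC (addrC (a i)) -segment_translate -minkowski_set1.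
  apply/seteqP; split=> [_ [_ -> [w sw <-]]|_ [w sw [_ -> <-]]].
    by exists w => //; exists (a i) => //; rewrite addrC.
  by exists (a i) => //; exists w => //; rewrite addrC.
rewrite (face_segment pP fa fa); first by rewrite segment_hull setUid conv_hull1.
move=> v vv fv; left; apply: above_a => //.
have [r er] := dir _ _ (sxy _ _ fa (segmentl _ _)) (sxy _ _ fa (segmentr _ _)).
have [r' er'] := dir _ _ (sxy _ _ fa (segmentl _ _)) (sxy _ _ fv (segmentl _ _)).
have E m : (hi 0 m - lo 0 m = r * (y 0 m - x 0 m)) /\
           (v 0 m - a i 0 m = r' * (y 0 m - x 0 m)).
  have := congr1 (fun p : pt => p 0 m) er; have := congr1 (fun p : pt => p 0 m) er'.
  by rewrite !mxE => <- <-; split; ring.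
have r0 : r != 0.
  have [e2 _] := E 2; have := zlh; rewrite /zcoord -subr_gt0 e2 => h.
  by apply: contraTneq h => ->; rewrite mul0r ltxx.
have h m : hi 0 m = lo 0 m -> v 0 m = a i 0 m.
  move=> em; have [] := E m; rewrite em subrr => /esym/eqP.
  by rewrite mulf_eq0 (negPf r0) /= => /eqP -> /eqP; rewrite mulr0 subr_eq0 => /eqP.
apply: eq_row3; rewrite /proj !mkptE; [exact: h| exact: h|].
by have := zcoord_a i; rewrite /zcoord.
Qed.

Lemma sum_position_lipschitz w w' : adjacent X w w' ->
  exists d d', [/\ sum_position w d, sum_position w' d' & (d' <= d + 1)%N].
Proof.
move=> /(adjacent_sum_cases xlh ylh zlh)[[s [u [v [f [-> -> sf uv e]]]]]|[f [f0 e]]].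
  have auv : adjacent P u v by apply/adjacentP; split=> //; exists f.
  have fu : face P f u by rewrite e; exact: segmentl.
  have fv : face P f v by rewrite e; exact: segmentr.
  have [[i hi']|[i [j [jl hu hv]]]] := edge_cases auv.
    have [m [ea eb em]] := ix_pred i.
    have sm : s = odd m.
      have e' : face P f = segment (a i) (a i.+1).
        by case: hi' => -[eu ev]; rewrite e eu ev // segmentC.
      have := signed_inj sf (a_signed e').
      by rewrite (odd_mod em) /= negbK.
    have p1 : sum_position (a i + endp s) (cyclic_norm N (2 * m + 3)).
      by rewrite ea sm; exact: sum_position_aS.
    have p2 : sum_position (a i.+1 + endp s) (cyclic_norm N (2 * m.+2)).
      by have := sum_position_a m.+2; rewrite -eb /= negbK -sm.
    case: hi' => -[-> ->].
      do 2 eexists; split; [exact: p1|exact: p2|].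
      by apply: cyclic_norm_lipschitz; lia.
    do 2 eexists; split; [exact: p2|exact: p1|].
    by apply: cyclic_norm_lipschitz; lia.
  have -> : s = odd i.
    have := face_signed sf fv; have := face_signed sf fu.
    by case: (quad_signed jl hu hv uv); case: (s) (odd i) => -[].
  have [x [px hx]] := sum_position_quad jl hu; have [x' [px' hx']] := sum_position_quad jl hv.
  do 2 eexists; split; [exact: px|exact: px'|].
  by apply: cyclic_norm_lipschitz; lia.
have [i ei] := face_vertical f0 e.
have [m [ea _ em]] := ix_pred i.
have p1 : sum_position (a i + endp (~~ odd m)) (cyclic_norm N (2 * m.+1)).
  by rewrite ea; exact: sum_position_a.
have p2 : sum_position (a i + endp (odd m)) (cyclic_norm N (2 * m + 3)).
  by rewrite ea; exact: sum_position_aS.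
have [le1 le2] : (cyclic_norm N (2 * m + 3) <= cyclic_norm N (2 * m.+1) + 1)%N /\
    (cyclic_norm N (2 * m.+1) <= cyclic_norm N (2 * m + 3) + 1)%N.
  by split; apply: cyclic_norm_lipschitz; lia.
case: (odd m) p1 p2 => /= p1 p2; have [[-> ->]|[-> ->]] := segment_inj ei;
  do 2 eexists; split; first [exact: p1|exact: p2|idtac];
  first [exact: p1|exact: p2|idtac]; by [].
Qed.

Lemma walk_sum m : walk X (a 0 + endp false) (a k + endp (odd k)) m -> (2 * k <= m)%N.
Proof.
move=> w.
have h0 : sum_position (a 0 + endp false) 0.
  by have := sum_position_a 0; rewrite muln0 cyclic_norm0.
have hk : sum_position (a k + endp (odd k)) (2 * k).
  by have := sum_position_a k; rewrite cyclic_norm_antipode.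
by have := walk_variation sum_position_fun sum_position_lipschitz w h0 hk; lia.
Qed.

Lemma diameter_sum : ((2 * k)%:R <= diameter X <= (2 * k + 12)%:R).
Proof.
have W12 u v : is_vertex X u -> is_vertex X v -> within X u v (2 * k + 12).
  by move=> vu vv; have := within_sum vu vv; rewrite l4 mul2n.
have vX i s : is_vertex X (a i + endp s).
  have [f [sf e]] := a_exposed_signed i s.
  exact: (vertex_sum xlh ylh zlh sf e).
apply/andP; split; last exact: (diameter_le W12 (vX 0%N true)).
exact: (diameter_ge W12 (vX 0%N false) (vX k (odd k)) walk_sum).
Qed.

End XiGraph.

(** * The limit of the ratio *)

Lemma vertical_segmentP (R : realType) (Sigma : set 'rV[R]_3) :
  vertical_segment Sigma -> exists lo hi,
    [/\ xcoord lo = xcoord hi, ycoord lo = ycoord hi, zcoord lo < zcoord hi &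
        Sigma = segment lo hi].
Proof.
move=> [u [v [uv ux uy ->]]]; have [h|h|h] := ltgtP (zcoord u) (zcoord v).
- by exists u, v.
- by exists v, u; rewrite segmentC.
- by case/eqP: uv; exact: eq_row3.
Qed.

(** The numerator differs from twice the denominator by a bounded quantity. *)
Lemma ratio_cvg2 (R : realType) (A B : nat -> R) (c d k0 : nat) :
  (forall k, (k0 <= k)%N -> k%:R <= A k <= (k + c)%:R) ->
  (forall k, (k0 <= k)%N -> (2 * k)%:R <= B k <= (2 * k + d)%:R) ->
  (fun k => B k / A k) @ \oo --> (2 : R).
Proof.
move=> hA hB; apply/cvgrPdist_le => e e0; near=> k.
have kk0 : (k0 <= k)%N by near: k; exact: nbhs_infty_ge.
have ke : (2 * c + d)%:R / e < k%:R by near: k; exact: nbhs_infty_gtr.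
have kp : 0 < k%:R :> R by apply: le_lt_trans ke; rewrite divr_ge0 // ltW.
have /andP[A1 A2] := hA k kk0; have /andP[B1 B2] := hB k kk0.
have Ap : 0 < A k by exact: lt_le_trans A1.
have -> : 2 - B k / A k = (2 * A k - B k) / A k by field; rewrite gt_eqF.
rewrite normrM normfV (gtr0_norm Ap) ler_pdivrMr //.
rewrite ltr_pdivrMr // in ke.
rewrite natrD in A2; rewrite natrM in B1; rewrite natrD natrM in B2.
rewrite natrD natrM in ke.
have eA : k%:R * e <= e * A k by rewrite mulrC ler_pM2l.
have c0 : 0 <= c%:R :> R by []; have d0 : 0 <= d%:R :> R by [].
rewrite ler_norml; apply/andP; split; lra.
Unshelve. all: by end_near.
Qed.

Theorem theorem4p3 (R : realType) (Xi : nat -> nat -> set 'rV[R]_3)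
    (hXi : forall k l : nat, (2 <= k)%N -> (2 <= l)%N -> is_Xi k l (Xi k l))
    (Sigma : set 'rV[R]_3) (hSigma : vertical_segment Sigma) :
  (fun k : nat =>
     diameter (minkowski_sum (Xi k 4%N) Sigma) / diameter (Xi k 4%N)) @ \oo
    --> (2 : R).
Proof.
have [lo [hi [xlh ylh zlh ->]]] := vertical_segmentP hSigma.
apply: (@ratio_cvg2 _ _ _ 10 12 2) => k k2.
  have [a [c [T [Q [t S]]]]] := hXi k 4%N k2 isT.
  exact: (diameter_Xi S k2 isT erefl).
have [a [c [T [Q [t S]]]]] := hXi k 4%N k2 isT.
exact: (diameter_sum S k2 isT erefl xlh ylh zlh).
Qed.
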